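(* Let $\mathcal{H}$ and $\mathcal{G}$ be real Hilbert spaces, let $L\in\mathcal{B}(\mathcal{H},\mathcal{G})$ be bounded below with $\|L\|\leq 1$, let $B\in\mathcal{S}(\mathcal{G})$, let $\gamma\in\,]0,+\infty[$, and let $t\in\,]0,1[$. Set $$\varphi\colon(\mathcal{S}(\mathcal{G}),d_T^{\mathcal{G}})\to(\mathcal{S}(\mathcal{H}),d_T^{\mathcal{H}})\colon X\mapsto L\overset{\gamma}{\bullet}(X\#_tB).$$ Then the following hold: (i) $\varphi$ is $(1-t)$-Lipschitzian. (ii) Suppose that $\mathcal{H}=\mathcal{G}$. Then the problem $$\text{find } X\in\mathcal{S}(\mathcal{H})\text{ such that } X=L\overset{\gamma}{\bullet}(X\#_tB)$$ admits a unique solution.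
   Context: $\mathcal{B}(\mathcal{H},\mathcal{G})$ is the space of bounded linear operators from $\mathcal{H}$ to $\mathcal{G}$, $\mathcal{B}(\mathcal{H})=\mathcal{B}(\mathcal{H},\mathcal{H})$, and $L^*$ is the adjoint of $L$. $\mathcal{P}(\mathcal{H})$ is the set of self-adjoint $A\in\mathcal{B}(\mathcal{H})$ with $\langle Ax,x\rangle\geq 0$ for all $x\in\mathcal{H}$. For self-adjoint $A,B$, $A\preccurlyeq B$ means $B-A\in\mathcal{P}(\mathcal{H})$. $\mathcal{S}(\mathcal{H})$ is the set of $A\in\mathcal{P}(\mathcal{H})$ for which there exists $\alpha>0$ with $\alpha\,\mathrm{Id}_{\mathcal{H}}\preccurlyeq A$. $L$ is bounded below if there exists $\alpha>0$ such that $\alpha\|x\|\leq\|Lx\|$ for all $x\in\mathcal{H}$. For a set-valued operator $M\colon\mathcal{G}\to 2^{\mathcal{G}}$, $M^{-1}$ is the set-valued inverse ($x\in M^{-1}y\Leftrightarrow y\in Mx$); sums and compositions are taken in the set-valued sense, e.g. $(L^*\circ M\circ L)x=\{L^*y : y\in M(Lx)\}$; a set-valued operator all of whose values are singletons is identified with the corresponding single-valued operator. The parallel composition of $M$ by $L^*$ is $L^*\triangleright M=(L^*\circ M^{-1}\circ L)^{-1}$. For $\gamma\in\,]0,+\infty[$, the resolvent composition is $L\overset{\gamma}{\diamond}M=L^*\triangleright(M+\gamma^{-1}\mathrm{Id}_{\mathcal{G}})-\gamma^{-1}\mathrm{Id}_{\mathcal{H}}$, and the resolvent cocomposition is $L\overset{\gamma}{\bullet}M=\bigl(L\overset{1/\gamma}{\diamond}M^{-1}\bigr)^{-1}$.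 The Thompson metric on $\mathcal{S}(\mathcal{H})$ is $d_T^{\mathcal{H}}(A,B)=\ln\bigl(\max\{g(A,B),g(B,A)\}\bigr)$, where $g(A,B)=\inf\{\lambda\in\,]0,+\infty[\; : A\preccurlyeq\lambda B\}$; similarly for $d_T^{\mathcal{G}}$. For $A,B\in\mathcal{S}(\mathcal{G})$ and $t\in[0,1]$, the $t$-weighted geometric mean is $A\#_tB=A^{1/2}\circ\bigl(A^{-1/2}\circ B\circ A^{-1/2}\bigr)^{t}\circ A^{1/2}$, with real powers defined by the continuous functional calculus. *)

(* Defs.v *)
From HB Require Import structures.
From mathcomp Require Import all_boot all_order all_algebra.
From mathcomp Require Import all_classical all_reals all_analysis.

Set Implicit Arguments.
Unset Strict Implicit.
Unset Printing Implicit Defensive.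

Import Order.TTheory GRing.Theory Num.Theory.
Import numFieldNormedType.Exports.

Local Open Scope classical_set_scope.
Local Open Scope ring_scope.

HB.mixin Record CompleteNormedModule_isRealHilbert (R : realType) (H : Type)
    of CompleteNormedModule R H := {
  hdot : {dot H for idfun};
  normr_hdot : forall x : H, `|x| ^+ 2 = hdot x x
}.

#[short(type="realHilbertType")]
HB.structure Definition RealHilbert (R : realType) :=
  {H of CompleteNormedModule_isRealHilbert R H & CompleteNormedModule R H}.

(* Operators are plain functions; membership in B(H, G), P(H), S(H) is a
   predicate. *)
Section BoundedOperators.
Variable R : realType.
Implicit Types H G : realHilbertType R.

Definition bounded_op H G : set (H -> G) :=
  [set L | linear L /\ exists M : R, forall x, `|L x| <= M * `|x|].

Definition opnorm H G (L : H -> G) : R := sup [set `|L x| | x in [set x | `|x| <= 1]].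

Definition bounded_below H G (L : H -> G) : Prop :=
  exists2 a : R, 0 < a & forall x, a * `|x| <= `|L x|.

(* For L in B(H, G), the z below exists and is unique by the Riesz
   representation theorem; the default value 0 is then never used. *)
Definition adjoint H G (L : H -> G) (y : G) : H :=
  xget 0 [set z | forall x, hdot (L x) y = hdot x z].

Definition self_adjoint H : set (H -> H) :=
  [set A | bounded_op A /\ adjoint A = A].

Definition psd H : set (H -> H) :=
  [set A | self_adjoint A /\ forall x, 0 <= hdot (A x) x].

Definition loewner_le H (A B : H -> H) : Prop := psd (B \- A).

Definition spd H : set (H -> H) :=
  [set A | psd A /\ exists2 a : R, 0 < a & loewner_le (a \*: idfun) A].

End BoundedOperators.

Section Thompson.
Variables (R : realType) (H : realHilbertType R).
Implicit Types A B : H -> H.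

Definition thompson_gauge A B : R :=
  inf [set l : R | 0 < l /\ loewner_le A (l \*: B)].

(* If H = {0}, both gauges are 0 and [ln 0 = 0] makes the distance 0. *)
Definition thompson_dist A B : R :=
  ln (Num.max (thompson_gauge A B) (thompson_gauge B A)).

End Thompson.

Section FunctionalCalculus.
Variables (R : realType) (H : realHilbertType R).
Implicit Types (A B T : H -> H) (f : R -> R) (p : {poly R}).

(* No complexification is needed: the (complex) spectrum of a self-adjoint
   operator is real. *)
Definition spectrum A : set R :=
  [set l | ~ exists T, [/\ bounded_op T,
    T \o (A \- l \*: idfun) = idfun & (A \- l \*: idfun) \o T = idfun]].

Definition poly_op p A : H -> H :=
  fun x => \sum_(i < size p) p`_i *: iter i A x.

(* T = f(A): T is the limit in operator norm of p_n(A) for polynomials p_n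
   converging to f uniformly on the spectrum of A.  For A self-adjoint and f
   continuous on the spectrum, such T exists (Weierstrass) and is unique since
   the norm of p(A) is the supremum of |p| on the spectrum. *)
Definition is_cfc f A T : Prop :=
  bounded_op T /\
  exists p_ : nat -> {poly R},
    {uniform spectrum A, (fun n => horner (p_ n)) @ \oo --> f} /\
    opnorm (poly_op (p_ n) A \- T) @[n --> \oo] --> (0 : R).

Definition cfc f A : H -> H := xget (fun=> 0) [set T | is_cfc f A T].

Definition op_pow A (s : R) : H -> H := cfc (fun l => l `^ s) A.

Definition geomean (t : R) A B : H -> H :=
  op_pow A 2^-1 \o
  op_pow (op_pow A (- 2^-1) \o B \o op_pow A (- 2^-1)) t \o
  op_pow A 2^-1.

End FunctionalCalculus.

(* A set-valued operator from U to V is a function U -> set V. *)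
Section SetValued.
Variable R : realType.
Implicit Types U V W : realHilbertType R.

Definition sv_single U V (f : U -> V) : U -> set V := fun x => [set f x].

Definition sv_inv U V (M : U -> set V) : V -> set U := fun y => [set x | M x y].

Definition sv_add U V (M N : U -> set V) : U -> set V :=
  fun x => [set u + v | u in M x & v in N x].

Definition sv_comp U V W (N : V -> set W) (M : U -> set V) : U -> set W :=
  fun x => \bigcup_(y in M x) N y.

Variables H G : realHilbertType R.
Implicit Types (L : H -> G) (M : G -> set G) (g : R).

(* Indexed by L, not L^*: this is L^* |> M = (L^* o M^-1 o L)^-1. *)
Definition parallel_comp L M : H -> set H :=
  sv_inv (sv_comp (sv_single (adjoint L))
                  (sv_comp (sv_inv M) (sv_single L))).

Definition resolvent_comp L g M : H -> set H :=
  sv_add (parallel_comp L (sv_add M (sv_single (g^-1 \*: idfun))))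
         (sv_single (- g^-1 \*: idfun)).

Definition resolvent_cocomp L g M : H -> set H :=
  sv_inv (resolvent_comp L g^-1 (sv_inv M)).

End SetValued.

(* Main.v *)
(* Write X #_t B = X^(1/2) D^t X^(1/2) with D = X^(-1/2) B X^(-1/2).  On a compact
   interval of positive reals, l^t is a uniform limit of positive combinations of
   functions l / (l + s).  The form of X^(1/2) (D / (D + s)) X^(1/2) at x is
     min_y <X y, y> + s^-1 <B (x - y), x - y>,
   which does not mention square roots; hence X <= m Y implies
   X #_t B <= m^(1-t) (Y #_t B).
   Likewise, the inverse of the cocomposition of M has at x the value
     min_(L^* y = x) <M^-1 y, y> + g (|y|^2 - |x|^2),
   where |L^* y| <= |y|; so M <= m M' with m >= 1 passes to the cocompositions
   with the same m.  Together these give the Lipschitz estimate, and the Picard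
   iterates from the identity are Cauchy in operator norm, with a limit that is
   fixed.  The functional calculus itself rests on the fact that a polynomial p
   with p >= b on the spectrum of A satisfies p(A) >= b. *)

Require Import Defs.
From mathcomp Require Import all_boot all_order all_algebra.
From mathcomp Require Import all_classical all_reals all_analysis.
From mathcomp Require Import ring lra complex.

Set Implicit Arguments.
Unset Strict Implicit.
Unset Printing Implicit Defensive.

Import Order.TTheory GRing.Theory Num.Theory.
Import numFieldNormedType.Exports.

Local Open Scope classical_set_scope.
Local Open Scope ring_scope.

Local Notation "'[ x , y ]" := (hdot x y) : ring_scope.

(** * Hilbert spaces and bounded operators *)

(** From X <= m Y alone one cannot compare the two operators D, because the factors X^(-1/2) change
    as well; only the whole form can be compared. The exponent 1 - t then comes from scaling: X <= m
    Y bounds the form for X with shift s by m times the form for Y with shift m s, and l / (l + m s)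
    is the fraction with shift s taken at l / m, so the t-th power contributes m * m^(-t). For
    cocompositions m >= 1 is imposed because g (|y|^2 - |x|^2) is nonnegative and does not scale
    with M; hence the fixed point argument handles only comparison constants K >= 1. Completeness of
    the Thompson metric is replaced by two-sided bounds between the iterates, whose constants are
    tails of a geometric series. Order relations are used throughout as inequalities between
    quadratic forms, and inverses come from Lax-Milgram. *)

Section Hilbert.
Variables (R : realType) (H : realHilbertType R).
Implicit Types (x y z : H) (a c : R).

Lemma dotDl x y z : '[x + y, z] = '[x, z] + '[y, z].
Proof. exact: linearDl. Qed.

Lemma dotC x y : '[x, y] = '[y, x].
Proof. by rewrite hermC /= expr0 mul1r. Qed.

Lemma dotZl a x y : '[a *: x, y] = a * '[x, y].
Proof. exact: linearZl_LR. Qed.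

Lemma dotDr x y z : '[x, y + z] = '[x, y] + '[x, z].
Proof. by rewrite !['[x, _]]dotC dotDl. Qed.

Lemma dotZr a x y : '[x, a *: y] = a * '[x, y].
Proof. by rewrite !['[x, _]]dotC dotZl. Qed.

Lemma dotNl x y : '[- x, y] = - '[x, y].
Proof. by rewrite -scaleN1r dotZl mulN1r. Qed.

Lemma dotNr x y : '[x, - y] = - '[x, y].
Proof. by rewrite -scaleN1r dotZr mulN1r. Qed.

Definition dotE := (dotDl, dotDr, dotZl, dotZr, dotNl, dotNr).

Lemma dot0l x : '[0, x] = 0.
Proof. by rewrite -(scale0r x) dotZl mul0r. Qed.

Lemma dotxx x : '[x, x] = `|x| ^+ 2.
Proof. by rewrite normr_hdot. Qed.

Lemma dot_inj x y : (forall z, '[x, z] = '[y, z]) -> x = y.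
Proof.
move=> xy; apply/eqP; rewrite -subr_eq0 -normr_eq0 -sqrf_eq0 -dotxx.
by rewrite dotDl dotNl xy subrr.
Qed.

(** The discriminant inequality, with no sign assumed on c. It serves both Cauchy-Schwarz
    inequalities and the Euler equation in [lax_milgram]. *)
Lemma quadratic_ge0 (a b c : R) :
  (forall s, 0 <= a + 2 * s * b + s ^+ 2 * c) -> b ^+ 2 <= a * c.
Proof.
move=> h; have a0 : 0 <= a by have := h 0; rewrite !(mulr0, mul0r, addr0, expr0n).
have [c0|c0|c0] := ltrgt0P c.
- have := h (- b / c); have -> : a + 2 * (- b / c) * b + (- b / c) ^+ 2 * c =
    (a * c - b ^+ 2) / c by field; rewrite gt_eqF.
  by rewrite pmulr_lge0 ?invr_gt0// subr_ge0.
(* Opposite points cancel the linear term, and 1 + w is far enough out for the sum of the two values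
   to be negative. *)
- exfalso; pose w := (a + 1) / - c; have w0 : 0 <= w.
    by rewrite divr_ge0 ?addr_ge0// oppr_ge0 ltW.
  have wc : w * c = - (a + 1) by rewrite /w; field; rewrite lt_eqF.
  have := h (1 + w); have := h (- (1 + w)); nra.
- rewrite c0 mulr0; have [->|b0] := eqVneq b 0; first by rewrite expr0n.
  exfalso; have := h (- (a + 1) / (2 * b)).
  have -> : a + 2 * (- (a + 1) / (2 * b)) * b = -1 by field.
  by rewrite c0; lra.
Qed.

Lemma dot_CS x y : '[x, y] ^+ 2 <= `|x| ^+ 2 * `|y| ^+ 2.
Proof.
rewrite -!dotxx; apply: quadratic_ge0 => s.
have := sqr_ge0 `|x + s *: y|; rewrite -dotxx !dotE ['[y, x]]dotC; lra.
Qed.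

Lemma dot_le x y : `| '[x, y] | <= `|x| * `|y|.
Proof.
rewrite -(@ler_pXn2r _ 2)// ?nnegrE ?mulr_ge0//.
by rewrite exprMn -normrX ger0_norm ?sqr_ge0// dot_CS.
Qed.

Lemma complete_seq (u : nat -> H) :
  (forall e : R, 0 < e -> exists N, forall n m, (N <= n)%N -> (N <= m)%N ->
    `|u n - u m| <= e) ->
  exists l, forall e : R, 0 < e -> exists N, forall n, (N <= n)%N ->
    `|u n - l| <= e.
Proof.
move=> cu; have /cauchy_cvgP cv : cauchy (u @ \oo).
  apply: cauchy_exP => e e0.
  have e20 : 0 < e / 2 by rewrite divr_gt0.
  have [N hN] := cu _ e20; exists (u N), N => // n /= Nn.
  rewrite /= -ball_normE /=; apply: le_lt_trans (hN _ _ (leqnn N) Nn) _.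
  by rewrite ltr_pdivrMr// ltr_pMr// ltrDl.
exists (lim (u @ \oo)) => e e0.
move/cvgrPdist_le: cv => /(_ e e0) [N _ hN]; exists N => n Nn.
by rewrite distrC; apply: hN.
Qed.

End Hilbert.

(** * Bounded and symmetric operators, Lax-Milgram *)

Section Operators.
Variables (R : realType).
Implicit Types H G K : realHilbertType R.

Section Linear.
Variables (H G : realHilbertType R) (L : H -> G).
Hypothesis linL : linear L.

Lemma op0 : L 0 = 0.
Proof. by have := linL (-1) 0 0; rewrite scaler0 addr0 scaleN1r addNr. Qed.

Lemma opD x y : L (x + y) = L x + L y.
Proof. by have := linL 1 x y; rewrite !scale1r. Qed.

Lemma opZ (a : R) x : L (a *: x) = a *: L x.
Proof. by have := linL a x 0; rewrite op0 !addr0. Qed.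

Lemma opN x : L (- x) = - L x.
Proof. by rewrite -scaleN1r opZ scaleN1r. Qed.

Lemma opB x y : L (x - y) = L x - L y.
Proof. by rewrite opD opN. Qed.

Definition opE := (opD, opZ, opN).

End Linear.

Lemma bounded_op_pos H G (L : H -> G) : bounded_op L ->
  exists2 M : R, 0 < M & forall x, `|L x| <= M * `|x|.
Proof.
move=> [_ [M LM]]; exists (`|M| + 1); first by rewrite ltr_wpDl.
move=> x; apply: le_trans (LM x) _; rewrite ler_wpM2r//.
by rewrite (le_trans (ler_norm M))// lerDl.
Qed.

Lemma bounded_op_comp H G K (L : H -> G) (M : G -> K) :
  bounded_op L -> bounded_op M -> bounded_op (M \o L).
Proof.
move=> bL bM; have [l l0 Ll] := bounded_op_pos bL.
have [m m0 Mm] := bounded_op_pos bM; case: bL bM => [linL _] [linM _].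
split; first by move=> a x y /=; rewrite linL linM.
exists (m * l) => x; apply: le_trans (Mm _) _.
by rewrite -mulrA ler_pM2l.
Qed.

Lemma bounded_op_id H : bounded_op (idfun : H -> H).
Proof. by split=> //; exists 1 => x; rewrite mul1r. Qed.

Lemma bounded_op_lin H G (L M : H -> G) (a : R) :
  bounded_op L -> bounded_op M -> bounded_op (fun x => a *: L x + M x).
Proof.
move=> bL bM; have [l l0 Ll] := bounded_op_pos bL.
have [m m0 Mm] := bounded_op_pos bM; case: bL bM => [linL _] [linM _].
split.
  by move=> b x y /=; rewrite linL linM !scalerDr !scalerA [b * a]mulrC addrACA.
exists (`|a| * l + m) => x; apply: le_trans (ler_normD _ _) _.
by rewrite normrZ mulrDl -mulrA lerD// ler_wpM2l.
Qed.

Lemma opnorm_le H G (L : H -> G) (M : R) :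
  0 <= M -> (forall x, `|L x| <= M * `|x|) -> opnorm L <= M.
Proof.
move=> M0 LM; apply: ge_sup; first by exists `|L 0|, 0 => //=; rewrite normr0.
move=> _ [x /= x1 <-]; apply: le_trans (LM x) _; exact: ler_piMr.
Qed.

Lemma le_opnorm H G (L : H -> G) x :
  bounded_op L -> `|L x| <= opnorm L * `|x|.
Proof.
move=> bL; have [l l0 Ll] := bounded_op_pos bL; case: bL => linL _.
have [->|x0] := eqVneq x 0; first by rewrite op0 // !normr0 mulr0.
have nx : 0 < `|x| by rewrite normr_gt0.
rewrite -ler_pdivrMr// mulrC -{1}[`|x|]normr_id -normfV -normrZ -opZ//.
apply: ub_le_sup.
  exists l => _ [y /= y1 <-]; apply: le_trans (Ll y) _.
  by apply: ler_piMr => //; exact: ltW.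
by exists (`|x|^-1 *: x) => //=; rewrite normrZ normfV normr_id mulVf// gt_eqF.
Qed.

Lemma opnorm_ge0 H G (L : H -> G) : bounded_op L -> 0 <= opnorm L.
Proof.
move=> bL; have [l l0 Ll] := bounded_op_pos bL.
apply: (@le_trans _ _ `|L 0|) => //; apply: ub_le_sup.
  exists l => _ [y /= y1 <-]; apply: le_trans (Ll y) _.
  by apply: ler_piMr => //; exact: ltW.
by exists 0 => //=; rewrite normr0.
Qed.

(** Self-adjointness without [adjoint]: adjoints are obtained from [lax_milgram], which is itself
    about such operators. [self_adjointP] shows that the two notions agree. *)
Definition symop H (A : H -> H) : Prop :=
  bounded_op A /\ forall x y, '[A x, y] = '[x, A y].

Definition coercive H (A : H -> H) : Prop :=
  exists2 a : R, 0 < a & forall x, a * `|x| ^+ 2 <= '[A x, x].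

Lemma symop_id H : symop (idfun : H -> H).
Proof. by split=> //; exact: bounded_op_id. Qed.

Lemma symop_lin H (A B : H -> H) (a : R) :
  symop A -> symop B -> symop (fun x => a *: A x + B x).
Proof.
move=> [bA sA] [bB sB]; split; first exact: bounded_op_lin.
by move=> x y; rewrite !dotE sA sB.
Qed.

Lemma symop_zero H : symop (fun _ : H => 0 : H).
Proof.
split=> [|x y]; last by rewrite [RHS]dotC !dot0l.
split; first by move=> a x y; rewrite scaler0 addr0.
by exists 0 => x; rewrite normr0 mul0r.
Qed.

Lemma symop_scale H (A : H -> H) (a : R) : symop A -> symop (a \*: A).
Proof.
move=> sA; have := symop_lin a sA (symop_zero H).
by congr symop; apply/funext => x; rewrite addr0.
Qed.

Lemma symop_add H (A B : H -> H) : symop A -> symop B -> symop (A \+ B).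
Proof.
move=> sA sB; have := symop_lin 1 sA sB.
by congr symop; apply/funext => x; rewrite scale1r.
Qed.

Lemma symop_sub H (A B : H -> H) : symop A -> symop B -> symop (A \- B).
Proof.
move=> sA sB; have := symop_lin (-1) sB sA.
by congr symop; apply/funext => x; rewrite scaleN1r addrC.
Qed.

Lemma form_CS H (A : H -> H) x y : symop A -> (forall x, 0 <= '[A x, x]) ->
  '[A x, y] ^+ 2 <= '[A x, x] * '[A y, y].
Proof.
move=> [[linA _] sA] A0; apply: quadratic_ge0 => s.
have := A0 (x + s *: y); rewrite !(opE linA) !dotE ['[A y, x]]sA ['[y, A x]]dotC.
lra.
Qed.

(** Polarisation and the parallelogram law bound 2 <T x, y> by c (|x|^2 + |y|^2); the best y is the
    multiple of T x that has the norm of x. *)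
Lemma symop_norm H (T : H -> H) (c : R) : symop T -> 0 <= c ->
  (forall x, `| '[T x, x] | <= c * `|x| ^+ 2) -> forall x, `|T x| <= c * `|x|.
Proof.
move=> [[linT bT] sT] c0 Tc x.
have pol y : 4 * '[T x, y] <= 2 * c * (`|x| ^+ 2 + `|y| ^+ 2).
  have := Tc (x + y); have := Tc (x - y); rewrite -!dotxx !ler_norml.
  rewrite !(opE linT) !dotE ['[T y, x]]sT ['[y, T x]]dotC ['[y, x]]dotC.
  by move=> /andP[h1 h2] /andP[h3 h4]; lra.
have [->|x0] := eqVneq x 0; first by rewrite op0// !normr0 mulr0.
have [->|Tx0] := eqVneq (T x) 0; first by rewrite normr0 mulr_ge0.
have nx : 0 < `|x| by rewrite normr_gt0.
have nT : 0 < `|T x| by rewrite normr_gt0.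
have := pol ((`|x| / `|T x|) *: T x).
rewrite dotZr dotxx normrZ ger0_norm ?divr_ge0// divfK ?gt_eqF//.
have -> : 4 * (`|x| / `|T x| * `|T x| ^+ 2) = 4 * `|x| * `|T x|.
  by field; rewrite gt_eqF.
nra.
Qed.

(** The solution is the limit of a minimising sequence of the energy J x = <A x, x> - 2 f x. *)
Lemma lax_milgram H (A : H -> H) (f : H -> R) :
  symop A -> coercive A ->
  (forall (a : R) x y, f (a *: x + y) = a * f x + f y) ->
  (exists M, forall x, `|f x| <= M * `|x|) ->
  exists x, forall v, '[A x, v] = f v.
Proof.
move=> [bA sA] [al al0 coA] linf [C fC].
have linA := bA.1; have [M M0 AM] := bounded_op_pos bA.
pose J x := '[A x, x] - 2 * f x.
have f0 : f 0 = 0 by have := linf (-1) 0 0; rewrite scaler0 addr0; lra.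
have fD x y : f (x + y) = f x + f y.
  by have := linf 1 x y; rewrite scale1r mul1r.
have fZ a x : f (a *: x) = a * f x.
  by have := linf a x 0; rewrite f0 !addr0.
(* With r = |x|, J x is at least al r^2 - 2 C r, whose least value over r is this one. *)
have Jlb x : - (C ^+ 2 / al) <= J x.
  rewrite -subr_ge0 opprK /J; have h1 := coA x.
  have h2 : f x <= C * `|x| by exact: le_trans (ler_norm _) (fC x).
  have h3 : 0 <= al * (`|x| - C / al) ^+ 2 by rewrite mulr_ge0 ?sqr_ge0// ltW.
  have e : al * (`|x| - C / al) ^+ 2 = al * `|x| ^+ 2 - 2 * C * `|x| + C ^+ 2 / al.
    by field; rewrite gt_eqF.
  rewrite e in h3; lra.
have iJ : has_inf (range J).
  by split; [exists (J 0), 0 | exists (- (C ^+ 2 / al)) => _ [x _ <-]].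
set m := inf (range J).
have Jm x : m <= J x by apply: ge_inf; [case: iJ | exists x].
have /choice[u uP] : forall n, exists x, J x < m + n.+1%:R^-1.
  move=> n; have n0 : 0 < n.+1%:R^-1 :> R by rewrite invr_gt0.
  by have [_ [x _ <-] hx] := inf_adherent n0 iJ; exists x.
(* Parallelogram identity for the form of A: J is at least m at the midpoint and almost m at both
   ends. *)
have close n k : al * `|u n - u k| ^+ 2 <= 2 * (n.+1%:R^-1 + k.+1%:R^-1).
  have := coA (u n - u k); have := Jm (2^-1 *: (u n + u k)).
  have := uP n; have := uP k; rewrite /J.
  rewrite !(opE linA, fD, fZ, dotE) ['[A (u k), u n]]sA ['[u k, A (u n)]]dotC.
  move: (n.+1%:R^-1) (k.+1%:R^-1) => p q; lra.
have smalln (e : R) : 0 < e -> exists N : nat, forall n, (N <= n)%N -> n.+1%:R^-1 <= e.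
  move=> e0; have [N _ hN] := near_infty_natSinv_lt (PosNum e0).
  by exists N => n Nn; apply/ltW/hN.
have [l ul] : exists l, forall e : R, 0 < e -> exists N, forall n, (N <= n)%N ->
    `|u n - l| <= e.
  apply: complete_seq => e e0.
  have e1 : 0 < al * e ^+ 2 / 4 by rewrite divr_gt0// mulr_gt0// exprn_gt0.
  have [N hN] := smalln _ e1; exists N => n k nN kN.
  rewrite -(@ler_pXn2r _ 2)// ?nnegrE//; last exact: ltW.
  rewrite -(ler_pM2l al0); apply: le_trans (close n k) _.
  have := hN _ nN; have := hN _ kN.
  move: (n.+1%:R^-1) (k.+1%:R^-1) => p q; lra.
(* Approximate Euler equation: J (u n + s v) >= m for all s, and J (u n) exceeds m by less than 1 /
   (n + 1), so the discriminant is controlled. *)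
have step n v : ('[A (u n), v] - f v) ^+ 2 <= n.+1%:R^-1 * '[A v, v].
  apply: quadratic_ge0 => s; have := Jm (u n + s *: v); have := uP n.
  rewrite /J !(opE linA, fD, fZ, dotE) ['[A v, u n]]sA ['[v, A (u n)]]dotC.
  move: (n.+1%:R^-1) => p; lra.
exists l => v; apply/eqP; rewrite -subr_eq0 -normr_le0.
apply/ler_addgt0Pr => e e0; rewrite add0r.
have Av0 : 0 <= '[A v, v].
  by apply: le_trans (coA v); rewrite mulr_ge0 ?sqr_ge0// ltW.
have e1 : 0 < (e / 2) ^+ 2 / ('[A v, v] + 1).
  by rewrite divr_gt0 ?exprn_gt0 ?divr_gt0// ltr_wpDl.
have e2 : 0 < e / 2 / (M * (`|v| + 1)).
  by rewrite divr_gt0 ?divr_gt0 ?mulr_gt0// ltr_wpDl.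
have [N1 h1] := smalln _ e1; have [N2 h2] := ul _ e2.
pose n := maxn N1 N2.
have e20 : 0 <= e / 2 by rewrite divr_ge0 ?ltW.
have {}h1 : `| '[A (u n), v] - f v| <= e / 2.
  rewrite -(@ler_pXn2r _ 2)// ?nnegrE//.
  rewrite -normrX ger0_norm ?sqr_ge0//; apply: le_trans (step n v) _.
  have := h1 n (leq_maxl _ _); rewrite ler_pdivlMr; last by rewrite ltr_wpDl.
  have : 0 < n.+1%:R^-1 :> R by rewrite invr_gt0.
  move: (n.+1%:R^-1) => p; nra.
have {}h2 : `| '[A (u n), v] - '[A l, v]| <= e / 2.
  rewrite -dotNl -dotDl -opB//; apply: (le_trans (dot_le _ _)).
  apply: le_trans (ler_wpM2r _ (AM _)) _ => //.
  have := h2 n (leq_maxr _ _); rewrite ler_pdivlMr; last first.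
    by rewrite mulr_gt0// ltr_wpDl.
  have := normr_ge0 v; have := normr_ge0 (u n - l); nra.
rewrite -[X in `|X|](subrKA '[A (u n), v]) .
apply: le_trans (ler_normD _ _) _.
by rewrite distrC; lra.
Qed.

End Operators.

(** * Adjoints, positive definite operators and their inverses, limits of operators *)

Section Adjoints.
Variables (R : realType).
Implicit Types H G K : realHilbertType R.

Lemma adjoint_eq H G (L : H -> G) (M : G -> H) :
  (forall x y, '[L x, y] = '[x, M y]) -> adjoint L = M.
Proof.
move=> LM; apply/funext => y; apply: xget_unique => [x|z hz]; first exact: LM.
by apply: dot_inj => x; rewrite ![ '[_, x]]dotC -hz LM.
Qed.

Lemma adjointP H G (L : H -> G) : bounded_op L ->
  forall x y, '[L x, y] = '[x, adjoint L y].
Proof.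
move=> bL x y.
have : exists z, forall x, '[L x, y] = '[x, z].
  (* Riesz representation is Lax-Milgram for the identity. *)
  have [| | | |z hz] := @lax_milgram _ H idfun (fun x => '[L x, y]).
  - exact: symop_id.
  - by exists 1 => // v; rewrite mul1r dotxx.
  - by move=> a v w; rewrite (bL.1) !dotE.
  - have [M M0 LM] := bounded_op_pos bL; exists (M * `|y|) => v.
    by rewrite (le_trans (dot_le _ _))// mulrAC ler_wpM2r.
  - by exists z => v; rewrite -hz dotC.
case=> z hz; pose E := [set z | forall x, '[L x, y] = '[x, z]].
by exact: (@xgetPex _ 0 E (ex_intro _ z hz)).
Qed.

Lemma bounded_op_adjoint H G (L : H -> G) : bounded_op L -> bounded_op (adjoint L).
Proof.
move=> bL; split.
  move=> a x y; apply: dot_inj => z; rewrite !dotE ![ '[adjoint L _, z]]dotC.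
  by rewrite -!(adjointP bL) !dotE.
have [M M0 LM] := bounded_op_pos bL; exists M => y.
have [->|y0] := eqVneq (adjoint L y) 0; first by rewrite normr0 mulr_ge0// ltW.
rewrite -(@ler_pM2r _ `|adjoint L y|) ?normr_gt0// -expr2 -dotxx -adjointP//.
apply: le_trans (ler_norm _) _; apply: le_trans (dot_le _ _) _.
by rewrite mulrAC ler_wpM2r.
Qed.

Lemma adjoint_contraction H G (L : H -> G) : bounded_op L -> opnorm L <= 1 ->
  forall y, `|adjoint L y| <= `|y|.
Proof.
move=> bL L1 y.
have [->|y0] := eqVneq (adjoint L y) 0; first by rewrite normr0.
rewrite -(@ler_pM2r _ `|adjoint L y|) ?normr_gt0// -expr2 -dotxx -adjointP//.
apply: le_trans (ler_norm _) _; apply: le_trans (dot_le _ _) _.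
rewrite mulrC ler_wpM2l//; apply: le_trans (le_opnorm _ bL) _.
by rewrite ler_piMl.
Qed.

Lemma self_adjointP H (A : H -> H) : self_adjoint A <-> symop A.
Proof.
split=> [[bA aA]|[bA sA]]; split=> //; last exact: adjoint_eq.
by move=> x y; rewrite adjointP// aA.
Qed.

Lemma loewnerP H (A B : H -> H) : symop A -> symop B ->
  loewner_le A B <-> forall x, '[A x, x] <= '[B x, x].
Proof.
move=> sA sB; split=> [[_ h] x|h].
  by have := h x; rewrite /= !dotE subr_ge0.
split; first exact/self_adjointP/symop_sub.
by move=> x; rewrite /= !dotE subr_ge0.
Qed.

Lemma spdP H (A : H -> H) : spd A <-> symop A /\ coercive A.
Proof.
split=> [[[/self_adjointP sA A0] [a a0 /loewnerP h]]|[sA [a a0 h]]].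
  split=> //; exists a => // x; rewrite -dotxx -dotZl.
  by apply: h => //; exact/symop_scale/symop_id.
split.
  split; first exact/self_adjointP.
  by move=> x; apply: le_trans (h x); rewrite mulr_ge0 ?sqr_ge0// ltW.
exists a => //; apply/loewnerP => //; first exact/symop_scale/symop_id.
by move=> x; rewrite /= dotZl dotxx.
Qed.

Lemma coercive_ge0 H (A : H -> H) x : coercive A -> 0 <= '[A x, x].
Proof.
by move=> [a a0 h]; apply: le_trans (h x); rewrite mulr_ge0 ?sqr_ge0// ltW.
Qed.

Lemma form_upper H (A : H -> H) : bounded_op A ->
  exists2 M, 0 < M & forall x, '[A x, x] <= M * `|x| ^+ 2.
Proof.
move=> bA; have [M M0 AM] := bounded_op_pos bA; exists M => // x.
apply: le_trans (ler_norm _) _; apply: le_trans (dot_le _ _) _.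
by rewrite expr2 mulrA ler_wpM2r.
Qed.

Lemma symop_eq H (A B : H -> H) : symop A -> symop B ->
  (forall x, '[A x, x] = '[B x, x]) -> A = B.
Proof.
move=> sA sB AB; apply/funext => x; apply/eqP; rewrite -subr_eq0 -normr_le0.
have := @symop_norm _ _ _ 0 (symop_sub sA sB) (lexx 0).
move/(_ _ x); rewrite mul0r; apply=> y.
by rewrite /= !dotE AB subrr normr0 mul0r.
Qed.

(** For A symmetric and coercive a preimage exists by [lax_milgram], so the default 0 is not
    reached. *)
Definition invop H (A : H -> H) (y : H) : H := xget 0 [set x | A x = y].

Section Inverse.
Variables (H : realHilbertType R) (A : H -> H).
Hypotheses (sA : symop A) (coA : coercive A).

Lemma coercive_inj : injective A.
Proof.
move=> x y Axy; apply/eqP; rewrite -subr_eq0 -normr_eq0 -sqrf_eq0 eq_le sqr_ge0.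
have [a a0 h] := coA; have := h (x - y); rewrite (opB sA.1.1) Axy subrr dot0l.
by rewrite pmulr_rle0// => ->.
Qed.

Lemma invopKr y : A (invop A y) = y.
Proof.
have [| |x hx] := @lax_milgram _ H A (fun x => '[y, x]) sA coA.
- by move=> a v w; rewrite !dotE.
- by exists `|y| => v; exact: dot_le.
by apply: (@xgetPex _ 0 [set x | A x = y]); exists x; exact: dot_inj.
Qed.

Lemma invopK x : invop A (A x) = x.
Proof. by apply: coercive_inj; rewrite invopKr. Qed.

Lemma symop_invop : symop (invop A).
Proof.
split; last by move=> x y; rewrite -{2}(invopKr x) sA.2 invopKr.
split; first by move=> a x y; apply: coercive_inj; rewrite sA.1.1 !invopKr.
have [a a0 h] := coA; exists a^-1 => y.
have [->|y0] := eqVneq (invop A y) 0.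
  by rewrite normr0 mulr_ge0// invr_ge0 ltW.
have ny : 0 < `|invop A y| by rewrite normr_gt0.
rewrite ler_pdivlMl// -(ler_pM2r ny) -mulrA -expr2.
apply: le_trans (h _) _; rewrite invopKr.
exact: le_trans (ler_norm _) (dot_le _ _).
Qed.

Lemma coercive_invop : coercive (invop A).
Proof.
have [a a0 h] := coA; have [M M0 AM] := bounded_op_pos sA.1.
exists (a / M ^+ 2); first by rewrite divr_gt0// exprn_gt0.
move=> y; rewrite -{3}(invopKr y) dotC; apply: le_trans (h _).
rewrite -mulrA ler_pM2l// ler_pdivrMl ?exprn_gt0// -exprMn.
rewrite ler_pXn2r// ?nnegrE//; last by rewrite mulr_ge0// ltW.
by rewrite -{1}(invopKr y).
Qed.

End Inverse.

(* <B^-1 x, x> = sup_y 2 <x, y> - <B y, y>, which is antitone in B. *)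
Lemma invop_le H (A B : H -> H) (c : R) : spd A -> spd B -> 0 < c ->
  (forall x, '[A x, x] <= c * '[B x, x]) ->
  forall x, '[invop B x, x] <= c * '[invop A x, x].
Proof.
move=> /spdP[sA cA] /spdP[sB cB] c0 AB x.
have := AB (invop B x); rewrite invopKr// ['[x, _]]dotC => h1.
(* With u = B^-1 x and v = A^-1 x this reads 0 <= <A u, u> - 2 c <x, u> + c^2 <x, v>, and <A u, u>
   <= c <x, u>. *)
have := coercive_ge0 (invop B x - c *: invop A x) cA.
have linA := sA.1.1; rewrite !(opE linA) !dotE invopKr//.
rewrite ['[A _, invop A x]]sA.2 invopKr// ['[x, invop B x]]dotC.
rewrite ['[x, invop A x]]dotC => h2.
rewrite -(ler_pM2l c0); nra.
Qed.

(** Completeness for the operator norm, with the norm written out pointwise; both the functional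
    calculus and the Picard iteration take their limits here. *)
Lemma symop_limit H (T : nat -> H -> H) : (forall n, symop (T n)) ->
  (forall e : R, 0 < e -> exists N, forall n m, (N <= n)%N -> (N <= m)%N ->
    forall x, `|T n x - T m x| <= e * `|x|) ->
  exists2 S, symop S & forall e : R, 0 < e -> exists N, forall n, (N <= n)%N ->
    forall x, `|T n x - S x| <= e * `|x|.
Proof.
move=> sT cT.
have /choice[S hS] : forall x, exists l, forall e : R, 0 < e ->
    exists N, forall n, (N <= n)%N -> `|T n x - l| <= e.
  move=> x; apply: complete_seq => e e0.
  have e1 : 0 < e / (`|x| + 1) by rewrite divr_gt0// ltr_wpDl.
  have [N hN] := cT _ e1; exists N => n m nN mN; apply: le_trans (hN _ _ nN mN x) _.
  by rewrite -mulrA ger_pMr// ler_pdivrMl ?mulr1 ?lerDl// ltr_wpDl.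
have unif (e : R) : 0 < e -> exists N, forall n, (N <= n)%N ->
    forall x, `|T n x - S x| <= e * `|x|.
  move=> e0; have [N hN] := cT _ e0; exists N => n nN x.
  apply/ler_addgt0Pr => d d0; have [K hK] := hS x _ d0.
  rewrite -[T n x - S x](subrKA (T (maxn N K) x)).
  apply: le_trans (ler_normD _ _) _; rewrite lerD ?hN ?leq_maxl//.
  by rewrite hK// leq_maxr.
exists S => //; split.
  split.
    move=> a x y; apply/eqP; rewrite -subr_eq0 -normr_le0.
    apply/ler_addgt0Pr => e e0; rewrite add0r.
    set c := `|a *: x + y| + `|a| * `|x| + `|y| + 1.
    have c0 : 0 < c by rewrite ltr_wpDl// !addr_ge0// mulr_ge0.
    have e1 : 0 < e / c by rewrite divr_gt0.
    have [N /(_ N (leqnn N)) hN] := unif _ e1.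
    have h1 := hN (a *: x + y); have h2 := hN x; have h3 := hN y.
    have -> : S (a *: x + y) - (a *: S x + S y) = 
       (S (a *: x + y) - T N (a *: x + y)) + (a *: (T N x - S x) + (T N y - S y)).
      by rewrite scalerBr [X in _ = _ + X]addrACA -opprD (sT N).1.1 addrA subrK.
    apply: le_trans (ler_normD _ _) _.
    have := ler_normD (a *: (T N x - S x)) (T N y - S y).
    rewrite [`|S _ - _|]distrC normrZ.
    have ce : e = e / c * c by rewrite divfK// gt_eqF.
    move: (e / c) ce e1 h1 h2 h3 => d ce d0 h1 h2 h3 h4.
    apply: (le_trans (lerD h1 h4)).
    rewrite ce /c; have := ler_wpM2l (normr_ge0 a) h2; nra.
  have [N /(_ N (leqnn N)) hN] := unif 1 ltr01.
  have [M M0 TM] := bounded_op_pos (sT N).1.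
  exists (M + 1) => x; have := hN x; have := TM x.
  have := ler_normD (T N x) (S x - T N x); rewrite subrKC distrC.
  by rewrite mulrDl; lra.
move=> x y; apply/eqP; rewrite -subr_eq0 -normr_le0.
apply/ler_addgt0Pr => e e0; rewrite add0r.
set c := 2 * (`|x| * `|y|) + 1.
have c0 : 0 < c by rewrite ltr_wpDl// !mulr_ge0.
have e1 : 0 < e / c by rewrite divr_gt0.
have [N /(_ N (leqnn N)) hN] := unif _ e1.
have -> : '[S x, y] - '[x, S y] = '[x, T N y - S y] - '[T N x - S x, y].
  by rewrite !dotE (sT N).2; lra.
apply: le_trans (ler_normB _ _) _.
have h1 := dot_le x (T N y - S y); have h2 := dot_le (T N x - S x) y.
have h3 := ler_wpM2l (normr_ge0 x) (hN y).
have h4 := ler_wpM2r (normr_ge0 y) (hN x).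
have ce : e = e / c * c by rewrite divfK// gt_eqF.
move: (e / c) ce h3 h4 e1 => d ce h3 h4 d0; rewrite ce /c; nra.
Qed.

End Adjoints.

(** * Polynomials of an operator and its spectrum *)

(** A complex root a + i b of q has b != 0, since q has no real root. The remainder of q by (X -
    a)^2 + b^2 is real, of degree at most 1, and vanishes at a + i b, so it is 0. *)
Lemma real_poly_quadratic_factor (R : realType) (q : {poly R}) :
  (1 < size q)%N -> (forall l, ~~ root q l) ->
  exists a b q', b != 0 /\ q = q' * (('X - a%:P) ^+ 2 + (b ^+ 2)%:P).
Proof.
move=> sq noroot; pose f : {rmorphism R -> complex R} := real_complex R.
have /closed_rootP[z qz] : size (map_poly f q) != 1%N.
  by rewrite size_map_poly gtn_eqF.
case: z qz => a b qz.
have b0 : b != 0.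
  apply/eqP => b0; move: qz; rewrite b0 -[Complex a 0]/(f a) fmorph_root.
  by apply/negP.
pose d : {poly R} := ('X - a%:P) ^+ 2 + (b ^+ 2)%:P.
have sd : size d = 3%N.
  rewrite /d size_polyDl size_exp_XsubC//.
  by rewrite size_polyC; case: (_ != 0).
have d0 : d != 0 by rewrite -size_poly_eq0 sd.
exists a, b, (q %/ d); split=> //.
rewrite [LHS](divp_eq q d); suff -> : q %% d = 0 by rewrite addr0.
set r := q %% d.
have sr : (size r <= 2)%N by rewrite -ltnS -sd ltn_modp.
have rE : r = (r`_1)%:P * 'X + (r`_0)%:P.
  apply/polyP => i; rewrite coefD coefMX !coefC.
  case: i => [|[|i]] /=; rewrite ?add0r ?addr0//.
  by rewrite nth_default// (leq_trans sr).
have dz : (map_poly f d).[Complex a b] = 0.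
  rewrite /d rmorphD rmorphXn rmorphB /= map_polyX !map_polyC /= !hornerE.
  apply/eqP; rewrite eq_complex /=; apply/andP; split; apply/eqP; ring.
move: qz; rewrite rootE [q](divp_eq q d) rmorphD rmorphM hornerD hornerM dz.
rewrite mulr0 add0r -/r rE rmorphD rmorphM /= map_polyX !map_polyC /= !hornerE.
rewrite eq_complex /= => /andP[/eqP h1 /eqP h2].
have r1 : r`_1 = 0.
  have : r`_1 * b = 0 by move: h2; lra.
  by move/eqP; rewrite mulf_eq0 (negPf b0) orbF => /eqP.
have r0 : r`_0 = 0 by move: h1; rewrite r1; lra.
by rewrite r1 r0 mul0r addr0.
Qed.

Section SpectralCalculus.
Variables (R : realType) (H : realHilbertType R).
Implicit Types (S T : H -> H).

(** [spectrum A l] is convertible to the negation of this for [A \- l \*: idfun], and proofs pass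
    from one to the other silently. *)
Definition invertible_op T := exists S,
  [/\ bounded_op S, S \o T = idfun & T \o S = idfun].

Lemma invertible_op_comp S T :
  invertible_op S -> invertible_op T -> invertible_op (S \o T).
Proof.
move=> [S' [bS S1 S2]] [T' [bT T1 T2]]; exists (T' \o S'); split.
- exact: bounded_op_comp.
- by rewrite -compA [S' \o _]compA S1.
- by rewrite -compA [T \o _]compA T2.
Qed.

Lemma invertible_op_coercive T : symop T -> coercive T -> invertible_op T.
Proof.
move=> sT cT; exists (invop T); split; first exact: (symop_invop sT cT).1.
  by apply/funext => x /=; rewrite invopK.
by apply/funext => x /=; rewrite invopKr.
Qed.

(** m is the infimum of the form on the unit sphere, which x0 shows to be nonempty. If S = T - m had
    a bounded inverse, the form of S would stay away from 0 on the sphere. *)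
Lemma form_inf_not_invertible T x0 : symop T -> x0 != 0 -> exists m,
  [/\ m * `|x0| ^+ 2 <= '[T x0, x0], forall x, m * `|x| ^+ 2 <= '[T x, x]
    & ~ invertible_op (T \- m \*: idfun)].
Proof.
move=> sT x00; have [K K0 TK] := bounded_op_pos sT.1.
pose E := [set '[T x, x] | x in [set x | `|x| = 1]].
have unit_vec x : x != 0 -> E ('[T x, x] / `|x| ^+ 2).
  move=> xn0; exists (`|x|^-1 *: x) => /=.
    by rewrite normrZ normfV normr_id mulVf// normr_eq0.
  rewrite (opZ sT.1.1) !dotE; field; by rewrite normr_eq0.
have iE : has_inf E.
  split; first by exists ('[T x0, x0] / `|x0| ^+ 2); exact: unit_vec.
  exists (- K) => _ [x /= x1 <-]; rewrite lerNl.
  apply: le_trans (ler_norm _) _; rewrite normrN.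
  by apply: le_trans (dot_le _ _) _; rewrite x1 mulr1 (le_trans (TK _))// x1 mulr1.
pose m := inf E; have mT x : m * `|x| ^+ 2 <= '[T x, x].
  have [->|x1] := eqVneq x 0; first by rewrite normr0 expr0n mulr0 (op0 sT.1.1) dot0l.
  rewrite -ler_pdivlMr ?exprn_gt0 ?normr_gt0//.
  by apply: ge_inf (unit_vec _ x1); case: iE.
exists m; split=> // -[V [bV VS _]].
have sS : symop (T \- m \*: idfun) by apply: symop_sub => //; exact/symop_scale/symop_id.
set S := T \- m \*: idfun in sS VS.
have Sx x : '[S x, x] = '[T x, x] - m * `|x| ^+ 2 by rewrite /= !dotE dotxx.
have S0 x : 0 <= '[S x, x] by rewrite Sx subr_ge0.
have [C C0 VC] := bounded_op_pos bV; have [D D0 SD] := bounded_op_pos sS.1.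
(* Cauchy-Schwarz for the form of S at x and S x gives |S x|^4 <= <S x, x> D |S x|^2. *)
have low x : `|x| ^+ 2 <= C ^+ 2 * D * '[S x, x].
  have h1 : `|x| <= C * `|S x| by rewrite -{1}[x]/(idfun x) -VS; exact: VC.
  have h2 : `|S x| ^+ 2 <= D * '[S x, x].
    have := form_CS x (S x) sS S0; rewrite dotxx.
    have h3 : '[S (S x), S x] <= D * `|S x| ^+ 2.
      apply: le_trans (ler_norm _) _; apply: le_trans (dot_le _ _) _.
      by rewrite expr2 mulrA ler_wpM2r.
    have [->|n0] := eqVneq `|S x| 0; first by rewrite expr0n mulr_ge0// ltW.
    have n1 : 0 < `|S x| ^+ 2 by rewrite exprn_gt0// lt_neqAle eq_sym n0 normr_ge0.
    move=> h4; rewrite -(ler_pM2r n1); have := ler_wpM2l (S0 x) h3.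
    by move: h4; rewrite expr2; nra.
  rewrite -mulrA; apply: le_trans (ler_wpM2l (sqr_ge0 C) h2).
  by rewrite -exprMn ler_pXn2r// ?nnegrE// mulr_ge0// ltW.
have e0 : 0 < (C ^+ 2 * D)^-1 by rewrite invr_gt0 mulr_gt0// exprn_gt0.
have [_ [x /= x1 <-]] := inf_adherent e0 iE; rewrite -/m => hx.
have := low x; rewrite Sx x1 expr1n mulr1.
have : C ^+ 2 * D * ('[T x, x] - m) < C ^+ 2 * D * (C ^+ 2 * D)^-1.
  by rewrite ltr_pM2l ?mulr_gt0 ?exprn_gt0// ltrBlDl.
rewrite divff; last by rewrite gt_eqF// mulr_gt0 ?exprn_gt0.
by move=> h1 h2; have := le_lt_trans h2 h1; rewrite ltxx.
Qed.

Section Polynomials.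
Variable A : H -> H.
Hypothesis sA : symop A.
Let linA : linear A := sA.1.1.
Implicit Types p q : {poly R}.

Lemma poly_opE n p x : (size p <= n)%N ->
  poly_op p A x = \sum_(i < n) p`_i *: iter i A x.
Proof.
move=> pn; rewrite /poly_op (big_ord_widen _ (fun i => p`_i *: iter i A x) pn).
rewrite big_mkcond /=; apply: eq_bigr => i _; case: ltnP => // ip.
by rewrite nth_default ?scale0r.
Qed.

Lemma poly_opD p q x : poly_op (p + q) A x = poly_op p A x + poly_op q A x.
Proof.
rewrite !(@poly_opE (maxn (size p) (size q))) ?leq_maxl ?leq_maxr ?size_polyD//.
by rewrite -big_split; apply: eq_bigr => i _; rewrite coefD scalerDl.
Qed.

Lemma poly_opZ a p x : poly_op (a *: p) A x = a *: poly_op p A x.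
Proof.
rewrite !(@poly_opE (size p)) ?size_scale_leq// scaler_sumr.
by apply: eq_bigr => i _; rewrite coefZ scalerA.
Qed.

Lemma poly_opN p x : poly_op (- p) A x = - poly_op p A x.
Proof. by rewrite -scaleN1r poly_opZ scaleN1r. Qed.

Lemma poly_opC c x : poly_op c%:P A x = c *: x.
Proof. by rewrite (@poly_opE 1) ?size_polyC_leq1// big_ord1 coefC. Qed.

Lemma poly_opMX p x : poly_op (p * 'X) A x = poly_op p A (A x).
Proof.
rewrite !(@poly_opE (size p).+1)//; last first.
  by have := size_polyMleq p 'X; rewrite size_polyX addn2.
rewrite big_ord_recl big_ord_recr /= coefMX scale0r add0r nth_default// scale0r addr0.
by apply: eq_bigr => i _; rewrite coefMX /= -iterSr.
Qed.

Lemma poly_op_ind (P : {poly R} -> (H -> H) -> Prop) :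
  P 0 (fun=> 0) ->
  (forall p c, P p (poly_op p A) ->
    P (p * 'X + c%:P) (fun x => poly_op p A (A x) + c *: x)) ->
  forall p, P p (poly_op p A).
Proof.
move=> P0 PS; elim/poly_ind => [|p c IH].
  by congr P: P0; apply/funext => x; rewrite -polyC0 poly_opC scale0r.
by congr P: (PS _ c IH); apply/funext => x; rewrite poly_opD poly_opMX poly_opC.
Qed.

Lemma poly_op_comm p x : poly_op p A (A x) = A (poly_op p A x).
Proof.
move: x; refine (@poly_op_ind (fun _ T => forall x, T (A x) = A (T x)) _ _ p).
  by move=> x; rewrite op0.
by move=> {}p c IH x /=; rewrite (opD linA) (opZ linA) IH.
Qed.

Lemma poly_opM p q x : poly_op (p * q) A x = poly_op p A (poly_op q A x).
Proof.
elim/poly_ind: p q x => [|p c IH] q x.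
  by rewrite mul0r -polyC0 !poly_opC !scale0r.
rewrite mulrDl -mulrA ['X * q]mulrC !poly_opD mul_polyC poly_opZ poly_opC.
by rewrite IH !poly_opMX poly_op_comm.
Qed.

Lemma symop_poly p : symop (poly_op p A).
Proof.
refine (@poly_op_ind (fun _ T => symop T) _ _ p); first exact: symop_zero.
move=> {}p c sp; apply: symop_add; last exact/symop_scale/symop_id.
split; first exact: (@bounded_op_comp _ _ _ _ A (poly_op p A) sA.1 sp.1).
by move=> x y; rewrite sp.2 sA.2 poly_op_comm.
Qed.

(** Factor q over the reals: a linear factor X - l has l outside the spectrum, and a quadratic one
    gives (A - a)^2 + b^2, which is coercive with constant b^2. *)
Lemma poly_op_invertible q : q != 0 ->
  (forall l, spectrum A l -> ~~ root q l) -> invertible_op (poly_op q A).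
Proof.
have [n] := ubnP (size q); elim: n => // n IH in q *; rewrite ltnS => qn q0 nr.
have [sq|sq] := leqP (size q) 1.
  have [c qE] : exists c, q = c%:P by exists q`_0; exact: size1_polyC.
  have c0 : c != 0 by move: q0; rewrite qE polyC_eq0.
  exists (c^-1 \*: idfun); split; first exact: (symop_scale _ (symop_id H)).1.
    by apply/funext => x /=; rewrite qE poly_opC scalerA mulVf// scale1r.
  by apply/funext => x /=; rewrite qE poly_opC scalerA mulfV// scale1r.
have [[l ql]|noroot] := pselect (exists l, root q l); last first.
  have [a [b [q' [b0 qE]]]] : exists a b q', b != 0 /\
      q = q' * (('X - a%:P) ^+ 2 + (b ^+ 2)%:P).
    apply: real_poly_quadratic_factor => // l.
    by apply/negP => ql; apply: noroot; exists l.
  set d := _ + _ in qE.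
  have -> : poly_op q A = poly_op q' A \o poly_op d A.
    by apply/funext => x /=; rewrite -poly_opM -qE.
  have q'0 : q' != 0 by apply: contraNneq q0 => q'0; rewrite qE q'0 mul0r.
  have sd : size d = 3%N.
    rewrite /d size_polyDl size_exp_XsubC//.
    by rewrite size_polyC; case: (_ != 0).
  have d0 : d != 0 by rewrite -size_poly_eq0 sd.
  apply: invertible_op_comp.
    apply: IH => //.
      by apply: leq_trans qn; rewrite qE size_mul// sd addn3 /= ltnS leqnSn.
    by move=> l sl; apply/negP => q'l; apply: noroot; exists l; rewrite qE rootM q'l.
  apply: invertible_op_coercive; first exact: symop_poly.
  exists (b ^+ 2); first by rewrite lt_neqAle eq_sym sqrf_eq0 b0 sqr_ge0.
  move=> x; rewrite /d poly_opD poly_opC dotDl dotZl dotxx expr2 poly_opM.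
  by rewrite (symop_poly _).2 dotxx lerDr sqr_ge0.
have /factor_theorem[q' qE] := ql.
have -> : poly_op q A = poly_op q' A \o poly_op ('X - l%:P) A.
  by apply/funext => x /=; rewrite -poly_opM -qE.
have q'0 : q' != 0 by apply: contraNneq q0 => q'0; rewrite qE q'0 mul0r.
apply: invertible_op_comp.
  apply: IH => //.
    by apply: leq_trans qn; rewrite qE size_mul// ?polyXsubC_eq0// size_XsubC addn2.
  by move=> k sk; apply: contra (nr k sk); rewrite qE rootM => ->.
have -> : poly_op ('X - l%:P) A = A \- l \*: idfun.
  apply/funext => x; rewrite poly_opD poly_opN poly_opC /=.
  by rewrite -['X]mul1r poly_opMX -polyC1 poly_opC scale1r.
by apply: contrapT => nl; have := nr l nl; rewrite ql.
Qed.

(* Otherwise the infimum m < b of the form of p(A) would be such that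
   p(A) - m is not invertible, although p - m has no root in the spectrum. *)
Lemma poly_op_lower p b : (forall l, spectrum A l -> b <= p.[l]) ->
  forall x, b * `|x| ^+ 2 <= '[poly_op p A x, x].
Proof.
move=> bp x0; rewrite leNgt; apply/negP => hx0.
have x00 : x0 != 0.
  by apply: contraTneq hx0 => ->; rewrite normr0 expr0n mulr0 dotC dot0l ltxx.
have n0 : 0 < `|x0| ^+ 2 by rewrite exprn_gt0 ?normr_gt0.
have [m [mx _ ninv]] := form_inf_not_invertible (symop_poly p) x00.
have mb : m < b by rewrite -(ltr_pM2r n0); exact: le_lt_trans hx0.
apply: ninv.
have -> : poly_op p A \- m \*: idfun = poly_op (p - m%:P) A.
  by apply/funext => x; rewrite poly_opD poly_opN poly_opC.
(* The spectrum of A contains some k; as p - m is positive there, it is not the zero polynomial. *)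
have [k [_ _ sk]] := form_inf_not_invertible sA x00.
have nz l : spectrum A l -> 0 < (p - m%:P).[l].
  by move=> sl; rewrite !hornerE subr_gt0; exact: lt_le_trans mb (bp _ sl).
apply: poly_op_invertible => [|l sl]; last by rewrite rootE gt_eqF// nz.
by apply: contraTneq (nz _ sk) => ->; rewrite horner0 ltxx.
Qed.

Lemma poly_op_norm p e : 0 <= e -> (forall l, spectrum A l -> `|p.[l]| <= e) ->
  forall x, `|poly_op p A x| <= e * `|x|.
Proof.
move=> e0 pe; apply: symop_norm => // [|x]; first exact: symop_poly.
rewrite ler_norml -mulNr; apply/andP; split.
  apply: poly_op_lower => l sl; have := pe l sl.
  by rewrite ler_norml => /andP[].
rewrite -lerN2 -mulNr -dotNl -poly_opN; apply: poly_op_lower => l sl.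
by have := pe l sl; rewrite ler_norml hornerN lerN2 => /andP[].
Qed.

Lemma spectrum_itv a b : (forall x, a * `|x| ^+ 2 <= '[A x, x]) ->
  (forall x, '[A x, x] <= b * `|x| ^+ 2) ->
  forall l, spectrum A l -> a <= l <= b.
Proof.
move=> hA hB l sl; apply/andP; split; rewrite leNgt; apply/negP => h; apply: sl.
  apply: invertible_op_coercive.
    by apply: symop_sub => //; exact/symop_scale/symop_id.
  exists (a - l); rewrite ?subr_gt0// => x.
  by rewrite /= !dotE dotxx mulrBl lerB.
have [| |S [bS S1 S2]] := @invertible_op_coercive (l \*: idfun \- A).
- by apply: symop_sub => //; exact/symop_scale/symop_id.
- exists (l - b); rewrite ?subr_gt0// => x.
  by rewrite /= !dotE dotxx mulrBl lerB.
have N : A \- l \*: idfun = fun x => - (l \*: idfun \- A) x.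
  by apply/funext => x /=; rewrite opprB.
exists (fun x => - S x); split.
- have := bounded_op_lin (-1) bS (symop_zero H).1.
  by congr bounded_op; apply/funext => x; rewrite scaleN1r addr0.
- apply/funext => x; rewrite /= -/((A \- l \*: idfun) x) N (opN bS.1) opprK.
  exact: (congr1 (@^~ x) S1).
- apply/funext => x; rewrite /= (opN linA) scalerN opprK addrC.
  exact: (congr1 (@^~ x) S2).
Qed.

End Polynomials.
End SpectralCalculus.

(** * Continuous functional calculus *)

Section FunctionalCalculusTheory.
Variables (R : realType) (H : realHilbertType R) (A : H -> H).
Hypothesis sA : symop A.
Implicit Types (T S : H -> H) (f g : R -> R) (p q : {poly R}).

(** [is_cfc] with its two limits replaced by one polynomial per accuracy. As a relation between f
    and T it supports sums and products with no prior existence or continuity result. *)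
Definition cfc_eps f T := bounded_op T /\ forall e : R, 0 < e ->
  exists2 p : {poly R}, (forall l, spectrum A l -> `|p.[l] - f l| <= e)
    & forall x, `|poly_op p A x - T x| <= e * `|x|.

Lemma is_cfcP f T : is_cfc f A T <-> cfc_eps f T.
Proof.
have bpT p : bounded_op T -> bounded_op (poly_op p A \- T).
  move=> bT; have := bounded_op_lin (-1) bT (symop_poly sA p).1.
  by congr bounded_op; apply/funext => x; rewrite scaleN1r addrC.
split=> [[bT [p_ [pf pT]]]|[bT hT]]; split=> //.
  move=> e e0.
  have /pf : nbhs (f : {uniform` spectrum A -> R})
      [set h | forall l, spectrum A l -> `|f l - h l| < e].
    apply/uniform_nbhs; exists [set xy | ball xy.1 e xy.2]; split.
      exact: (@entourage_ball _ _ (PosNum e0)).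
    by move=> h /= hb l /hb; rewrite -ball_normE.
  move=> [N1 _ h1]; move/cvgrPdist_lt: pT => /(_ e e0) [N2 _ h2].
  exists (p_ (maxn N1 N2)).
    move=> l sl; rewrite distrC; apply/ltW.
    exact: (h1 (maxn N1 N2) (leq_maxl _ _) l sl).
  move=> x; have := h2 (maxn N1 N2) (leq_maxr _ _).
  rewrite sub0r normrN => h.
  apply: le_trans (le_opnorm _ (bpT (p_ (maxn N1 N2)) bT)) _.
  by rewrite ler_wpM2r// ltW//; apply: le_lt_trans h; exact: ler_norm.
have /choice[p_ hp] : forall n : nat, exists p : {poly R},
    (forall l, spectrum A l -> `|p.[l] - f l| <= n.+1%:R^-1)
    /\ forall x, `|poly_op p A x - T x| <= n.+1%:R^-1 * `|x|.
  by move=> n; have [|p h1 h2] := hT n.+1%:R^-1; [rewrite invr_gt0|exists p].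
exists p_; split.
  move=> P /= /uniform_nbhs[E [entE EP]].
  move: entE; rewrite -entourage_ballE => -[e /= e0 eE].
  have [N _ hN] := near_infty_natSinv_lt (PosNum e0).
  exists N => // n /= /hN nN; apply: EP => l sl; apply: eE.
  rewrite /= -ball_normE /= distrC; apply: le_lt_trans nN.
  exact: (hp n).1.
apply/cvgrPdist_lt => e e0.
have [N _ hN] := near_infty_natSinv_lt (PosNum e0).
exists N => // n /= /hN nN; rewrite sub0r normrN; apply: le_lt_trans nN.
have h : opnorm (poly_op (p_ n) A \- T) <= n.+1%:R^-1.
  by apply: opnorm_le (hp n).2; rewrite invr_ge0.
by rewrite ger0_norm// opnorm_ge0//; exact: bpT.
Qed.

Lemma cfc_eps_poly p : cfc_eps (horner p) (poly_op p A).
Proof.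
split; first exact: (symop_poly sA p).1.
move=> e e0; exists p => [l _|x]; first by rewrite subrr normr0 ltW.
by rewrite subrr normr0 mulr_ge0// ltW.
Qed.

Lemma eq_cfc_eps f g T : (forall l, spectrum A l -> f l = g l) ->
  cfc_eps f T -> cfc_eps g T.
Proof.
move=> fg [bT hT]; split=> // e /hT[p h1 h2]; exists p => // l sl.
by rewrite -fg// h1.
Qed.

Lemma cfc_eps_const c : cfc_eps (fun=> c) (c \*: idfun).
Proof.
have := cfc_eps_poly c%:P.
have -> : poly_op c%:P A = c \*: idfun by apply/funext => x; rewrite poly_opC.
by apply: eq_cfc_eps => l _; rewrite hornerC.
Qed.

Lemma cfc_eps_id : cfc_eps id A.
Proof.
have := cfc_eps_poly 'X.
have -> : poly_op 'X A = A.
  by apply/funext => x; rewrite -['X]mul1r poly_opMX -polyC1 poly_opC scale1r.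
by apply: eq_cfc_eps => l _; rewrite hornerX.
Qed.

Lemma cfc_eps_lin a f g T S : cfc_eps f T -> cfc_eps g S ->
  cfc_eps (fun l => a * f l + g l) (fun x => a *: T x + S x).
Proof.
move=> [bT hT] [bS hS]; split; first exact: bounded_op_lin.
move=> e e0; have a0 : 0 < `|a| + 1 by rewrite ltr_wpDl.
have e1 : 0 < e / (`|a| + 1) by rewrite divr_gt0.
have [p p1 p2] := hT _ e1; have [q q1 q2] := hS _ e1.
have ea : e = e / (`|a| + 1) * (`|a| + 1) by rewrite divfK// gt_eqF.
move: (e / (`|a| + 1)) ea e1 p1 p2 q1 q2 => d ea d0 p1 p2 q1 q2.
exists (a *: p + q) => [l sl|x].
  rewrite !hornerE opprD addrACA -mulrBr.
  apply: le_trans (ler_normD _ _) _; rewrite normrM ea mulrDr mulr1 lerD ?q1//.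
  by rewrite mulrC ler_wpM2r// p1.
rewrite poly_opD poly_opZ opprD addrACA -scalerBr.
apply: le_trans (ler_normD _ _) _; rewrite normrZ ea mulrDr mulr1 mulrDl.
by rewrite lerD ?q2// mulrAC [leRHS]mulrC ler_wpM2l// p2.
Qed.

Lemma symop_cfc_eps f T : cfc_eps f T -> symop T.
Proof.
move=> [bT hT]; split=> // x y; apply/eqP; rewrite -subr_eq0 -normr_le0.
apply/ler_addgt0Pr => e e0; rewrite add0r.
set c := 2 * (`|x| * `|y|) + 1.
have c0 : 0 < c by rewrite ltr_wpDl// !mulr_ge0.
have e1 : 0 < e / c by rewrite divr_gt0.
have [p _ hN] := hT _ e1.
have -> : '[T x, y] - '[x, T y] =
    '[x, poly_op p A y - T y] - '[poly_op p A x - T x, y].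
  by rewrite !dotE (symop_poly sA p).2; lra.
apply: le_trans (ler_normB _ _) _.
have h1 := dot_le x (poly_op p A y - T y); have h2 := dot_le (poly_op p A x - T x) y.
have h3 := ler_wpM2l (normr_ge0 x) (hN y).
have h4 := ler_wpM2r (normr_ge0 y) (hN x).
have ce : e = e / c * c by rewrite divfK// gt_eqF.
move: (e / c) ce h3 h4 e1 => d ce h3 h4 d0; rewrite ce /c; nra.
Qed.

Lemma cfc_eps_lower f T b : cfc_eps f T -> (forall l, spectrum A l -> b <= f l) ->
  forall x, b * `|x| ^+ 2 <= '[T x, x].
Proof.
move=> [bT hT] bf x; apply/ler_addgt0Pr => e e0.
set c := 2 * `|x| ^+ 2 + 1.
have c0 : 0 < c by rewrite ltr_wpDl// !mulr_ge0.
have e1 : 0 < e / c by rewrite divr_gt0.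
have ce : e = e / c * c by rewrite divfK// gt_eqF.
have [p p1 p2] := hT _ e1; move: (e / c) ce p1 p2 e1 => d ce p1 p2 d0.
have h1 : (b - d) * `|x| ^+ 2 <= '[poly_op p A x, x].
  apply: poly_op_lower => // l sl.
  by have := p1 l sl; have := bf l sl; rewrite ler_norml => h /andP[h' _]; lra.
have h2 : '[poly_op p A x, x] - '[T x, x] <= d * `|x| ^+ 2.
  rewrite -dotNl -dotDl; apply: le_trans (ler_norm _) _.
  apply: le_trans (dot_le _ _) _.
  by rewrite expr2 mulrA ler_wpM2r.
rewrite ce /c; nra.
Qed.

Lemma cfc_eps_dist f g T S e : cfc_eps f T -> cfc_eps g S -> 0 <= e ->
  (forall l, spectrum A l -> `|f l - g l| <= e) ->
  forall x, `| '[T x, x] - '[S x, x]| <= e * `|x| ^+ 2.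
Proof.
move=> hT hS e0 fg x; rewrite ler_norml.
have := @cfc_eps_lower _ _ (- e) (cfc_eps_lin (-1) hS hT) _ x.
have := @cfc_eps_lower _ _ (- e) (cfc_eps_lin (-1) hT hS) _ x.
rewrite !dotE !mulN1r => h1 h2; apply/andP; split.
  suff h l : spectrum A l -> - e <= -1 * g l + f l by have := h2 h; lra.
  by move=> sl; have := fg l sl; rewrite ler_norml => /andP[]; lra.
suff h l : spectrum A l -> - e <= -1 * f l + g l by have := h1 h; lra.
by move=> sl; have := fg l sl; rewrite ler_norml => /andP[]; lra.
Qed.

Lemma cfc_eps_unique f T S : cfc_eps f T -> cfc_eps f S -> T = S.
Proof.
move=> hT hS; apply: symop_eq (symop_cfc_eps hT) (symop_cfc_eps hS) _ => x.
apply/eqP; rewrite -subr_eq0 -normr_le0 -(mul0r (`|x| ^+ 2)).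
by apply: (cfc_eps_dist hT hS) => // l sl; rewrite subrr normr0.
Qed.

(** On the spectrum f is within 1 of a polynomial, which is bounded there because the spectrum
    is. *)
Lemma cfc_eps_bounded f T : cfc_eps f T ->
  exists2 M, 0 < M & forall l, spectrum A l -> `|f l| <= M.
Proof.
move=> [_ /(_ 1 ltr01)[p p1 _]].
have [C C0 AC] := bounded_op_pos sA.1.
have [M hM] := poly_disk_bound p C.
exists (`|M| + 1) => [|l sl]; first by rewrite ltr_wpDl.
have /hM h1 : `|l| <= C.
  rewrite ler_norml; apply: spectrum_itv sl => // x.
    rewrite mulNr lerNl -dotNl; apply: le_trans (ler_norm _) _.
    by apply: le_trans (dot_le _ _) _; rewrite normrN expr2 mulrA ler_wpM2r.
  apply: le_trans (ler_norm _) _.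
  by apply: le_trans (dot_le _ _) _; rewrite expr2 mulrA ler_wpM2r.
have h2 := ler_normB p.[l] (p.[l] - f l); rewrite subKr in h2.
apply: le_trans h2 _; apply: lerD; last exact: p1.
exact: le_trans h1 (ler_norm _).
Qed.

Lemma cfc_eps_mul f g T S : cfc_eps f T -> cfc_eps g S ->
  cfc_eps (fun l => f l * g l) (T \o S).
Proof.
move=> hT hS; have [F F0 fF] := cfc_eps_bounded hT.
have [G G0 gG] := cfc_eps_bounded hS.
case: hT hS => [bT hT] [bS hS]; split; first exact: bounded_op_comp.
have [M M0 TM] := bounded_op_pos bT; have [N N0 SN] := bounded_op_pos bS.
move=> e e0; pose c := F + G + M + N + 1.
have c0 : 0 < c by rewrite /c; lra.
(* d <= 1 absorbs the product of the two errors; c covers both the scalar and the operator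
   estimate. *)
pose d := Num.min 1 (e / c).
have d0 : 0 < d by rewrite lt_min ltr01 divr_gt0.
have d1 : d <= 1 by rewrite ge_min lexx.
have dc : d * c <= e by rewrite -ler_pdivlMr// ge_min lexx orbT.
have [p p1 p2] := hT d d0; have [q q1 q2] := hS d d0.
exists (p * q) => [l sl|x].
  have -> : (p * q).[l] - f l * g l =
      (p.[l] - f l) * (q.[l] - g l) + (f l * (q.[l] - g l) + (p.[l] - f l) * g l).
    by rewrite hornerM; ring.
  apply: le_trans (ler_normD _ _) _.
  have := ler_normD (f l * (q.[l] - g l)) ((p.[l] - f l) * g l).
  rewrite !normrM => h; apply: (le_trans (lerD (lexx _) h)).
  apply: le_trans dc; have := p1 l sl; have := q1 l sl; have := fF l sl; have := gG l sl.
  move: (normr_ge0 (p.[l] - f l)) (normr_ge0 (q.[l] - g l)).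
  move: (normr_ge0 (f l)) (normr_ge0 (g l)).
  move: `|p.[l] - f l| `|q.[l] - g l| `|f l| `|g l| => P Q f' g' f0 g0 P0 Q0 h1 h2 h3 h4.
  rewrite /c; have := ler_pM P0 Q0 h4 h3; have := ler_pM f0 Q0 h2 h3.
  have := ler_pM P0 g0 h4 h1; nra.
rewrite poly_opM//=.
have -> : poly_op p A (poly_op q A x) - T (S x) =
   (poly_op p A (poly_op q A x) - T (poly_op q A x)) + T (poly_op q A x - S x).
  by rewrite (opB bT.1) addrA subrK.
apply: le_trans (ler_normD _ _) _; apply: le_trans (lerD (p2 _) (TM _)) _.
have h1 : `|poly_op q A x| <= (1 + N) * `|x|.
  rewrite -[poly_op q A x](subrK (S x)); apply: le_trans (ler_normD _ _) _.
  rewrite mulrDl lerD// (le_trans (q2 x))// ler_wpM2r//.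
apply: le_trans (ler_wpM2r (normr_ge0 x) dc).
have := ler_wpM2l (ltW d0) h1; have := ler_wpM2l (ltW M0) (q2 x).
have : 0 <= d * (F + G) * `|x| by rewrite !mulr_ge0 ?addr_ge0// ltW.
rewrite /c; nra.
Qed.

Lemma cfc_eps_limit f (p_ : nat -> {poly R}) :
  (forall e : R, 0 < e -> exists N, forall n, (N <= n)%N ->
     forall l, spectrum A l -> `|(p_ n).[l] - f l| <= e) ->
  exists T, cfc_eps f T.
Proof.
move=> hp.
have [n|e e0|T sT hT] := @symop_limit _ H (fun n => poly_op (p_ n) A).
- exact: symop_poly.
- have e1 : 0 < e / 2 by rewrite divr_gt0.
  have [N hN] := hp _ e1; exists N => n m nN mN x.
  rewrite -poly_opN -poly_opD; apply: poly_op_norm => //; first exact: ltW.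
  move=> l sl; rewrite !hornerE -[X in `|X|](subrKA (f l)).
  apply: le_trans (ler_normD _ _) _; have := hN n nN l sl; have := hN m mN l sl.
  by rewrite [`|f l - _|]distrC; lra.
exists T; split; first exact: sT.1.
move=> e e0; have [N1 h1] := hp _ e0; have [N2 h2] := hT _ e0.
exists (p_ (maxn N1 N2)) => [l sl|x].
  by apply: h1 => //; exact: leq_maxl.
by apply: h2; exact: leq_maxr.
Qed.

End FunctionalCalculusTheory.

(** * Bernstein polynomials and functional calculus of Lipschitz functions *)

Section Weierstrass.
Variable R : realType.
Implicit Types (g h : nat -> R) (x c : R).

(* [bern n g] is the Bernstein polynomial of degree n of the nodes g 0, ..., g n,
   i.e. x |-> E[g K] for K binomial of parameters n and x. *)
Fixpoint bern n g : {poly R} :=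
  if n is n'.+1 then 'X * bern n' (g \o succn) + (1 - 'X) * bern n' g
  else (g 0%N)%:P.

Lemma bernS n g x :
  (bern n.+1 g).[x] = x * (bern n (g \o succn)).[x] + (1 - x) * (bern n g).[x].
Proof. by rewrite /= !hornerE. Qed.

Lemma bern_le n g h x : 0 <= x <= 1 ->
  (forall k, (k <= n)%N -> g k <= h k) -> (bern n g).[x] <= (bern n h).[x].
Proof.
move=> /andP[x0 x1]; elim: n g h => [|n IH] g h gh.
  by rewrite /= !hornerC gh.
rewrite !bernS lerD// ler_wpM2l ?subr_ge0//; apply: IH => k kn; apply: gh => //.
exact: leqW.
Qed.

Lemma bern_lin n (a : R) g h x :
  (bern n (fun k => a * g k + h k)).[x] = a * (bern n g).[x] + (bern n h).[x].
Proof.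
elim: n g h => [|n IH] g h; first by rewrite /= !hornerC.
rewrite !bernS IH; have := IH (g \o succn) (h \o succn).
by rewrite /comp => ->; ring.
Qed.

Lemma bern_const n c x : (bern n (fun=> c)).[x] = c.
Proof.
elim: n => [|n IH]; first by rewrite /= hornerC.
by rewrite bernS; have := IH; rewrite /comp => ->; ring.
Qed.

(** Squared bias plus variance of a binomial variable. The induction needs c general, since shifting
    the nodes by one turns c into c - 1. *)
Lemma bern_moment2 n c x :
  (bern n (fun k => (k%:R - c) ^+ 2)).[x] = (n%:R * x - c) ^+ 2 + n%:R * x * (1 - x).
Proof.
elim: n c => [|n IH] c; first by rewrite /= hornerC !mul0r addr0.
rewrite bernS IH.
have -> : (fun k => (k%:R - c) ^+ 2) \o succn = fun k => (k%:R - (c - 1)) ^+ 2.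
  by apply/funext => k /=; rewrite -natr1; congr (_ ^+ 2); ring.
by rewrite IH -natr1; ring.
Qed.

(** F is f transported to [0, 1], with Lipschitz constant L. The error of its Bernstein polynomial
    is an expectation of |F(K/n) - F(u)|, controlled by the variance. *)
Lemma weierstrass_lipschitz (f : R -> R) (a b K : R) : a < b -> 0 < K ->
  (forall x y, a <= x <= b -> a <= y <= b -> `|f x - f y| <= K * `|x - y|) ->
  forall e : R, 0 < e -> exists p : {poly R},
    forall x, a <= x <= b -> `|p.[x] - f x| <= e.
Proof.
move=> ab K0 fK e e0; have ba : 0 < b - a by rewrite subr_gt0.
pose L := K * (b - a); have L0 : 0 < L by rewrite mulr_gt0.
have [d d0 Ld] : exists2 d, 0 < d & L * d = e / 2.
  exists (e / (2 * L)); first by rewrite divr_gt0// mulr_gt0.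
  by field; rewrite gt_eqF.
(* Makes the variance term L u (1 - u) / (d n) at most e / 2; the other half of e is L d. *)
have [n n0 hn] : exists2 n : nat, 0 < n%:R :> R & 2 * L / (d * e) < n%:R.
  exists (Num.truncn (2 * L / (d * e))).+1; first by rewrite ltr0n.
  exact: truncnS_gt.
pose F u := f (a + (b - a) * u).
pose p := bern n (fun k => F (k%:R / n%:R)).
have itv u : 0 <= u <= 1 -> a <= a + (b - a) * u <= b.
  move=> /andP[u0 u1]; nra.
(* The bound |w| <= d + w^2 / d lets a second moment control the Lipschitz estimate. *)
have FL u v : 0 <= u <= 1 -> 0 <= v <= 1 ->
    `|F u - F v| <= L * (d + (u - v) ^+ 2 / d).
  move=> u01 v01; apply: le_trans (fK _ _ (itv u u01) (itv v v01)) _.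
  have -> : a + (b - a) * u - (a + (b - a) * v) = (b - a) * (u - v) by ring.
  rewrite normrM (gtr0_norm ba) mulrA ler_pM2l//.
  rewrite -(ler_pM2r d0) mulrDl divfK ?gt_eqF// -(real_normK (num_real (u - v))).
  have := sqr_ge0 (`|u - v| - d); have := normr_ge0 (u - v); nra.
have pF u : 0 <= u <= 1 -> `|p.[u] - F u| <= e.
  move=> u01.
  have up : (bern n (fun k => (L / d / n%:R ^+ 2) * (k%:R - n%:R * u) ^+ 2
       + L * d)).[u] <= e.
    rewrite bern_lin bern_moment2 bern_const subrr expr0n add0r Ld.
    have h1 : L / d / n%:R ^+ 2 * (n%:R * u * (1 - u)) =
       L / d / n%:R * (u * (1 - u)) by field; rewrite !gt_eqF.
    have h2 : L / d / n%:R <= e / 2.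
      rewrite ler_pdivrMr// ler_pdivrMr//.
      move/ltW: hn; rewrite ler_pdivrMr ?mulr_gt0//; nra.
    have h3 : 0 <= L / d / n%:R by rewrite !divr_ge0// ltW.
    rewrite h1; move/andP: u01 => [u0 u1]; nra.
  have Fk k : (k <= n)%N -> `|F (k%:R / n%:R) - F u| <=
      L / d / n%:R ^+ 2 * (k%:R - n%:R * u) ^+ 2 + L * d.
    move=> kn; apply: le_trans (FL _ _ _ u01) _.
      by rewrite divr_ge0//= ler_pdivrMr// mul1r ler_nat.
    by rewrite le_eqVlt; apply/orP; left; apply/eqP; field; rewrite !gt_eqF.
  have pE (s : R) : s * (p.[u] - F u) =
      (bern n (fun k => s * F (k%:R / n%:R) + - s * F u)).[u].
    by rewrite bern_lin bern_const -/p; ring.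
  rewrite ler_norml; apply/andP; split.
    rewrite lerNl -mulN1r pE; apply: le_trans up; apply: bern_le => // k kn.
    by have := Fk k kn; rewrite ler_norml => /andP[h _]; move: h; lra.
  rewrite -[leLHS]mul1r pE; apply: le_trans up; apply: bern_le => // k kn.
  by have := Fk k kn; rewrite ler_norml => /andP[_]; lra.
exists (p \Po ((b - a)^-1 *: ('X - a%:P))) => x /andP[ax xb].
rewrite horner_comp !hornerE.
have u01 : 0 <= (b - a)^-1 * (x - a) <= 1.
  rewrite mulr_ge0 ?invr_ge0 ?subr_ge0// ?(ltW ab)//=.
  by rewrite ler_pdivrMl// mulr1 lerB.
have := pF _ u01; rewrite /F mulrA divff ?gt_eqF// mul1r.
by rewrite [a + _]addrC subrK.
Qed.

(** Mean value theorem. The power c^(s - 1) is monotone in c, in a direction that depends on s, so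
    the sum of its values at a and b bounds it in both cases. *)
Lemma powR_lipschitz (s a b : R) : 0 < a -> exists2 K : R, 0 < K &
  forall x y, a <= x <= b -> a <= y <= b -> `|x `^ s - y `^ s| <= K * `|x - y|.
Proof.
move=> a0; pose K := `|s| * (a `^ (s - 1) + b `^ (s - 1)) + 1.
have K0 : 0 < K by rewrite ltr_wpDl// mulr_ge0// addr_ge0// powR_ge0.
have bound c : a <= c <= b -> `|s * c `^ (s - 1)| <= K.
  move=> /andP[ac cb]; rewrite normrM (ger0_norm (powR_ge0 _ _)) /K.
  apply: ler_wpDr => //; apply: ler_wpM2l => //.
  have c0 : 0 < c := lt_le_trans a0 ac.
  have [s1|s1] := leP 0 (s - 1).
    apply: ler_wpDl; first exact: powR_ge0.
    by apply: ge0_ler_powR; rewrite ?nnegrE// ?ltW// (lt_le_trans c0).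
  apply: ler_wpDr; first exact: powR_ge0.
  rewrite -(opprB 1 s) !powRN lef_pV2 ?posrE ?powR_gt0//.
  apply: ge0_ler_powR; rewrite ?nnegrE ?(ltW a0) ?(ltW c0)//.
  by rewrite subr_ge0; lra.
exists K => //.
suff h x y : a <= x -> x <= y -> y <= b -> `|x `^ s - y `^ s| <= K * `|x - y|.
  move=> x y /andP[ax xb] /andP[ay yb]; have [xy|/ltW yx] := leP x y; first exact: h.
  by rewrite distrC [`|x - y|]distrC h.
move=> ax xy yb.
have der (z : R) : 0 < z -> is_derive z 1 (fun z : R => z `^ s) (s * z `^ (s - 1)).
  by move=> z0; exact: is_derive1_powR.
have [z| |c] := @MVT_segment R (fun z : R => z `^ s)
    (fun z : R => s * z `^ (s - 1)) x y xy.
- rewrite in_itv /= => /andP[xz _]; apply: der; apply: lt_trans xz.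
  exact: lt_le_trans ax.
- apply: continuous_in_subspaceT => z; rewrite inE /= in_itv /= => /andP[xz _].
  apply: differentiable_continuous; apply/derivable1_diffP.
  have z0 : 0 < z by apply: lt_le_trans xz; exact: lt_le_trans ax.
  by have [] := der z z0.
rewrite in_itv /= => /andP[xc cy] e; rewrite distrC e normrM [`|x - y|]distrC.
by apply: ler_wpM2r => //; apply: bound; rewrite (le_trans ax)//= (le_trans cy).
Qed.

Lemma cfc_eps_exists (H : realHilbertType R) (A : H -> H) (f : R -> R) (a b K : R) :
  symop A -> a < b ->
  (forall x : H, a * `|x| ^+ 2 <= '[A x, x]) ->
  (forall x : H, '[A x, x] <= b * `|x| ^+ 2) ->
  0 < K ->
  (forall x y, a <= x <= b -> a <= y <= b -> `|f x - f y| <= K * `|x - y|) ->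
  exists T, cfc_eps A f T.
Proof.
move=> sA ab aA bA K0 fK.
have /choice[p_ hp] : forall n : nat, exists p : {poly R},
    forall x, a <= x <= b -> `|p.[x] - f x| <= n.+1%:R^-1.
  by move=> n; apply: (weierstrass_lipschitz ab K0 fK); rewrite invr_gt0.
apply: (cfc_eps_limit sA (p_ := p_)) => e e0.
have [N _ hN] := near_infty_natSinv_lt (PosNum e0).
exists N => n /hN /ltW nN l sl; apply: le_trans nN; apply: hp.
exact: spectrum_itv sl.
Qed.

End Weierstrass.

(** * Approximation of powers by sums of fractions *)

Section PowerApproximation.
Variable R : realType.
Implicit Types (x y a b t e : R).

Definition frac_sum (r : seq (R * R)) x := \sum_(i <- r) i.1 * (x / (x + i.2)).

Lemma le_frac x y (s : R) : 0 <= x -> x <= y -> 0 < s -> x / (x + s) <= y / (y + s).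
Proof.
move=> x0 xy s0; have ? : 0 < x + s by rewrite ltr_wpDl.
have ? : 0 < y + s by rewrite ltr_wpDl// (le_trans x0).
rewrite ler_pdivrMr// mulrAC ler_pdivlMr//.
by rewrite !mulrDr [y * x]mulrC lerD2l ler_wpM2r// ltW.
Qed.

Lemma expr_unbounded (r C : R) : 1 < r -> exists n, C <= r ^+ n.
Proof.
move=> r1; have r10 : 0 < r - 1 by rewrite subr_gt0.
have bern n : 1 + n%:R * (r - 1) <= r ^+ n.
  elim: n => [|n IH]; first by rewrite mul0r addr0 expr0.
  rewrite exprS -natr1; have n0 : 0 <= n%:R :> R by [].
  have := mulr_ge0 n0 (sqr_ge0 (r - 1)).
  have := ler_wpM2l (ltW (lt_trans ltr01 r1)) IH.
  by move: (r ^+ n) (n%:R) => u k; lra.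
exists (Num.truncn (C / (r - 1))).+1.
apply: le_trans (bern _); apply: ler_wpDl => //.
by rewrite -ler_pdivrMr// ltW// truncnS_gt.
Qed.

Section Sums.
Variables (q p : R).
Hypotheses (p1 : 1 < p) (pq : p < q).
Let q0 : 0 < q. Proof. by move: p1 pq; lra. Qed.
Let p0 : 0 < p. Proof. by move: p1; lra. Qed.

(** With p = q^t, a Riemann sum on a logarithmic scale, at the nodes s = q^j, of the integral of
    s^(t - 1) x / (x + s), which is a constant times x^t. *)
Definition geom_frac n x := \sum_(j < n) p ^+ j * (x / (x + q ^+ j)).

Lemma geom_frac_le n x y : 0 <= x -> x <= y -> geom_frac n x <= geom_frac n y.
Proof.
move=> x0 xy; apply: ler_sum => i _; apply: ler_wpM2l.
  by rewrite exprn_ge0// ltW.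
by apply: le_frac; rewrite // exprn_gt0.
Qed.

(* Rescaling by q shifts the index of the sum, whence the quasi-homogeneity
   of [geom_frac n], up to the two boundary terms. *)
Lemma geom_frac_scale n x : 0 < x -> q * x * (p / q) ^+ n <= 1 ->
  p * geom_frac n x - 1 <= geom_frac n (q * x) <= p * geom_frac n x + 1.
Proof.
move=> x0 hn; have qx : 0 < q * x by rewrite mulr_gt0.
have e1 : geom_frac n.+1 (q * x) = q * x / (q * x + 1) + p * geom_frac n x.
  rewrite /geom_frac big_ord_recl expr0 mul1r; congr (_ + _).
  rewrite mulr_sumr; apply: eq_bigr => i _; rewrite lift0 !exprS.
  have : 0 < q ^+ i by rewrite exprn_gt0.
  move: (q ^+ i) (p ^+ i) => u v u0; field.
  by rewrite gt_eqF//= -?mulrDr ?mulf_neq0 ?gt_eqF// addr_gt0.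
have e2 : geom_frac n.+1 (q * x) =
    geom_frac n (q * x) + p ^+ n * (q * x / (q * x + q ^+ n)).
  by rewrite /geom_frac big_ord_recr.
have qn : 0 < q ^+ n by rewrite exprn_gt0.
have pn : 0 < p ^+ n by rewrite exprn_gt0.
have b1 : 0 <= q * x / (q * x + 1) <= 1.
  have ? : 0 < q * x + 1 by rewrite addr_gt0.
  rewrite divr_ge0 ?(ltW qx) ?addr_ge0 ?(ltW qx)//=.
  by rewrite ler_pdivrMr// mul1r; lra.
have b2 : 0 <= p ^+ n * (q * x / (q * x + q ^+ n)) <= 1.
  have ? : 0 < q * x + q ^+ n by rewrite addr_gt0.
  rewrite mulr_ge0 ?divr_ge0 ?addr_ge0 ?(ltW qx) ?(ltW qn) ?(ltW pn)//=.
  apply: le_trans hn; rewrite expr_div_n mulrA [leRHS]mulrA [p ^+ n * _]mulrC.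
  apply: ler_wpM2l; first by rewrite mulr_ge0// ltW.
  by rewrite lef_pV2 ?posrE// lerDr ltW.
move: e1 b1 b2; rewrite e2 => e1 /andP[b1 b1'] /andP[b2 b2'].
by apply/andP; split; lra.
Qed.

End Sums.

(** The ratio h would be constant for an exact power. A step from x to q x moves it by at most d, by
    [geom_frac_scale]; inside one period [l0, q l0] monotonicity costs a factor p and one more d.
    The induction counts periods. *)
Lemma powR_approx_geom (q t l0 L : R) (n k : nat) (p := q `^ t) (d := (l0 `^ t)^-1)
    (h := fun x => geom_frac q p n x / x `^ t) :
  0 < t < 1 -> 1 < q -> 0 < l0 -> q * L * (p / q) ^+ n <= 1 -> l0 * q ^+ k.+1 <= L ->
  forall x, l0 <= x <= l0 * q ^+ k.+1 ->
  p^-1 * h l0 - k.+1%:R * d <= h x <= p * h l0 + k.+1%:R * d.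
Proof.
move=> /andP[t0 t1] q1 l00 hL; have q0 : 0 < q := lt_trans ltr01 q1.
have p1 : 1 < p.
  have := @gt0_ltr_powR R t t0 1 q; rewrite powR1; apply=> //; rewrite nnegrE// ltW//.
have pq : p < q.
  by rewrite -[ltRHS](powRr1 (ltW q0)) /p /powR gt_eqF// ltr_expR ltr_pM2r ?ln_gt0.
have p0 : 0 < p := lt_trans ltr01 p1.
have lt0 : 0 < l0 `^ t by rewrite powR_gt0.
have d0 : 0 < d by rewrite invr_gt0.
have qpow x : 0 < x -> (q * x) `^ t = p * x `^ t.
  by move=> x0; rewrite powRM// ltW.
have hn x : x <= L -> q * x * (p / q) ^+ n <= 1.
  move=> xL; apply: le_trans hL; apply: ler_wpM2r.
    by rewrite exprn_ge0// divr_ge0// ltW.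
  by apply: ler_wpM2l => //; exact: ltW.
have step x : 0 < x -> x <= L -> l0 <= q * x -> `|h (q * x) - h x| <= d.
  move=> x0 xL lx; have /andP[s1 s2] := geom_frac_scale p1 pq x0 (hn x xL).
  have xt : 0 < x `^ t by rewrite powR_gt0.
  have -> : h (q * x) - h x =
      (geom_frac q p n (q * x) - p * geom_frac q p n x) / (q * x) `^ t.
    by rewrite /h qpow//; field; rewrite !gt_eqF.
  have qxt : l0 `^ t <= (q * x) `^ t.
    by apply: ge0_ler_powR; rewrite ?nnegrE ?mulr_ge0 ?(ltW t0) ?(ltW l00)
      ?(ltW q0) ?(ltW x0).
  have qxt0 := lt_le_trans lt0 qxt.
  rewrite normrM normfV (gtr0_norm qxt0) ler_pdivrMr//.
  apply: (@le_trans _ _ 1); first by rewrite ler_norml; apply/andP; split; lra.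
  by rewrite mulrC -ler_pdivrMr ?invr_gt0// invrK mul1r.
elim: k => [|k IH] kL x /andP[lx xl].
  have x0 : 0 < x := lt_le_trans l00 lx.
  have xt : l0 `^ t <= x `^ t.
    by apply: ge0_ler_powR; rewrite ?nnegrE ?(ltW t0) ?(ltW l00) ?(ltW x0).
  rewrite expr1 mulrC in xl.
  have xt' : x `^ t <= p * l0 `^ t.
    rewrite -qpow//.
    by apply: ge0_ler_powR; rewrite ?nnegrE ?mulr_ge0 ?(ltW t0) ?(ltW l00)
      ?(ltW q0) ?(ltW x0).
  have xt0 := lt_le_trans lt0 xt.
  have G0 : 0 <= geom_frac q p n l0.
    apply: sumr_ge0 => i _; rewrite mulr_ge0 ?divr_ge0 ?addr_ge0 ?exprn_ge0 ?ltW//.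
  have g1 := geom_frac_le p1 pq n (ltW l00) lx.
  have g2 := geom_frac_le p1 pq n (ltW x0) xl.
  have l0L : l0 <= L.
    by apply: le_trans kL; rewrite expr1 ler_pMr// ltW.
  have /andP[_ s2] := geom_frac_scale p1 pq l00 (hn l0 l0L).
  apply/andP; split.
    apply: (@le_trans _ _ (p^-1 * h l0)); first by rewrite mul1r lerBlDr lerDl ltW.
    rewrite /h mulrCA; apply: (@le_trans _ _ (geom_frac q p n l0 * (x `^ t)^-1)).
      by apply: ler_wpM2l => //; rewrite -invfM lef_pV2 ?posrE ?mulr_gt0.
    by apply: ler_wpM2r => //; rewrite invr_ge0 ltW.
  rewrite mul1r /h mulrA -[d]mul1r -mulrDl.
  apply: (@le_trans _ _ ((p * geom_frac q p n l0 + 1) / x `^ t)).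
    by apply: ler_wpM2r; [rewrite invr_ge0 ltW|exact: le_trans s2].
  by apply: ler_wpM2l; rewrite ?lef_pV2// addr_ge0// mulr_ge0// ltW.
have [xs|xs] := leP x (l0 * q ^+ k.+1).
  have /andP[i1 i2] : p^-1 * h l0 - k.+1%:R * d <= h x <= p * h l0 + k.+1%:R * d.
    apply: IH; last by rewrite lx.
    apply: le_trans kL; apply: ler_wpM2l; first exact: ltW.
    by rewrite [leRHS]exprS ler_peMl ?exprn_ge0 ?ltW.
  by rewrite -(natr1 k.+1); apply/andP; split; lra.
have qy : q * (x / q) = x by rewrite mulrC divfK// gt_eqF.
have y0 : 0 < x / q by rewrite divr_gt0// (lt_le_trans l00).
have lqk : l0 <= l0 * q ^+ k.+1 by rewrite ler_pMr// exprn_ege1// ltW.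
have yx : x / q <= x by rewrite ler_pdivrMr// ler_pMr ?(lt_le_trans l00)// ltW.
have ly : l0 <= x / q <= l0 * q ^+ k.+1.
  rewrite ler_pdivlMr// ler_pdivrMr// -mulrA -exprSr xl andbT.
  apply: le_trans (ltW xs); apply: ler_wpM2l; first exact: ltW.
  by rewrite exprS ler_peMr ?exprn_ege1// ltW.
have := step (x / q) y0 (le_trans yx (le_trans xl kL)); rewrite qy => /(_ lx).
rewrite ler_norml => /andP[s1 s2].
have lkL : l0 * q ^+ k.+1 <= L.
  apply: le_trans kL; apply: ler_wpM2l; first exact: ltW.
  by rewrite [leRHS]exprS ler_peMl ?exprn_ge0 ?ltW.
have /andP[i1 i2] := IH lkL _ ly.
by rewrite -(natr1 k.+1); apply/andP; split; lra.
Qed.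

(** Powers are compatible with scaling, so [a, b] is moved far out, to start at l0 = q^M, where the
    boundary terms of [geom_frac] are negligible. Dividing by [h l0] normalises the sum without
    evaluating the integral. *)
Lemma powR_approx t a b e : 0 < t < 1 -> 0 < a -> 0 < e -> exists2 r : seq (R * R),
  all (fun i => (0 <= i.1) && (0 < i.2)) r &
  forall x, a <= x <= b -> `|frac_sum r x - x `^ t| <= e.
Proof.
move=> t01 a0 e0; have /andP[t0 t1] := t01.
have [B B0 hB] : exists2 B, 0 < B & b `^ t <= B.
  by exists (b `^ t + 1); rewrite ?lerDl// ltr_wpDl// powR_ge0.
have [f f0 fe] : exists2 f, 0 < f & f * B <= e.
  by exists (e / B); rewrite ?divr_gt0// divfK// gt_eqF.
(* f is the relative accuracy. Half of it goes to the factor p lost inside a period; as h l0 >= 1/2,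
   the total boundary error is allowed f / 4. *)
have [p p1 pf] : exists2 p, 1 < p & p - 1 = f / 2.
  by exists (1 + f / 2); rewrite ?ltrDl ?divr_gt0// addrC addKr.
have p0 : 0 < p := lt_trans ltr01 p1.
have [q q0 qt] : exists2 q, 0 < q & q `^ t = p.
  exists (p `^ t^-1); first exact: powR_gt0.
  by rewrite -powRrM mulVf ?gt_eqF// powRr1// ltW.
have q1 : 1 < q.
  rewrite ltNge; apply/negP => q1.
  have : q `^ t <= 1 `^ t by apply: ge0_ler_powR; rewrite ?nnegrE// ltW.
  by rewrite powR1 qt leNgt p1.
have pq : p < q.
  by rewrite -qt -[ltRHS](powRr1 (ltW q0)) /powR gt_eqF// ltr_expR ltr_pM2r ?ln_gt0.
have [k hk] := expr_unbounded (b / a) q1.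
have [M hM] := expr_unbounded (4 * k.+1%:R / f) p1.
pose l0 := q ^+ M; have l00 : 0 < l0 by rewrite exprn_gt0.
have l0t : l0 `^ t = p ^+ M.
  by rewrite /l0 -powR_mulrn ?(ltW q0)// powRAC qt powR_mulrn// ltW.
pose L := l0 * q ^+ k.+1; have L0 : 0 < L by rewrite mulr_gt0// exprn_gt0.
have qp : 1 < q / p by rewrite ltr_pdivlMr// mul1r.
have [m hm] := expr_unbounded (q * L) qp.
(* m makes the last boundary term at most 1; [M.+1] puts the index M into the sum. *)
pose n := maxn m M.+1.
have hn : q * L * (p / q) ^+ n <= 1.
  have -> : p / q = (q / p)^-1 by rewrite invf_div.
  rewrite exprVn ler_pdivrMr ?mul1r ?exprn_gt0 ?divr_gt0//.
  apply: le_trans hm _; apply: ler_weXn2l; first exact: ltW.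
  exact: leq_maxl.
have := powR_approx_geom t01 q1 l00 (n := n) (k := k) (L := L).
rewrite /= qt => /(_ hn (lexx _)) main.
set h := fun x => geom_frac q p n x / x `^ t.
(* The term j = M alone gives p^M / 2, and l0^t = p^M. *)
have h0 : 2^-1 <= h l0.
  rewrite /h l0t ler_pdivlMr ?exprn_gt0// mulrC.
  have Mn : (M < n)%N by exact: leq_maxr.
  rewrite /geom_frac (bigD1 (Ordinal Mn))//=.
  have -> : l0 / (l0 + q ^+ M) = 2^-1.
    by rewrite -/l0; field; rewrite !gt_eqF ?addr_gt0.
  rewrite lerDl; apply: sumr_ge0 => i _.
  have ? : 0 < q ^+ i by rewrite exprn_gt0.
  by rewrite mulr_ge0 ?exprn_ge0 ?divr_ge0 ?addr_ge0 ?(ltW p0) ?(ltW l00)// ltW.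
have h00 : 0 < h l0 by apply: lt_le_trans h0; rewrite invr_gt0.
have small : k.+1%:R * (p ^+ M)^-1 <= f / 4.
  have pM : 0 < p ^+ M by rewrite exprn_gt0.
  move: hM; rewrite !ler_pdivrMr// => hM.
  by move: (k.+1%:R) (p ^+ M) hM => u v hM; lra.
have dist y : l0 <= y <= l0 * q ^+ k.+1 -> `|h y / h l0 - 1| <= f.
  move=> /main; rewrite -/(h y) -/(h l0) l0t => /andP[i1 i2].
  have pV : 2 - p <= p^-1.
    rewrite -(ler_pM2r p0) mulVf ?gt_eqF//; have := sqr_ge0 (p - 1); lra.
  move: (k.+1%:R * _) small i1 i2 => s small i1 i2.
  rewrite ler_norml lerBlDr lerBrDr ler_pdivlMr// ler_pdivrMr//.
  have h1 := ler_wpM2r (ltW h00) pV; have h2 := ler_wpM2l (ltW f0) h0.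
  have pE : p = 1 + f / 2 by rewrite -pf addrC subrK.
  by move: h1 h2 i1 i2; rewrite pE => h1 h2 i1 i2; apply/andP; split; lra.
pose c := l0 / a; have c0 : 0 < c by rewrite divr_gt0.
have ct : 0 < c `^ t by rewrite powR_gt0.
exists [seq (p ^+ j / (h l0 * c `^ t), q ^+ j / c) | j <- index_iota 0 n].
  apply/allP => _ /mapP[j _ ->] /=.
  rewrite (divr_ge0 (exprn_ge0 _ (ltW p0)) (mulr_ge0 (ltW h00) (ltW ct)))/=.
  by rewrite divr_gt0// exprn_gt0.
move=> x /andP[ax xb]; have x0 : 0 < x := lt_le_trans a0 ax.
have cx0 : 0 < c * x by rewrite mulr_gt0.
have -> : frac_sum [seq (p ^+ j / (h l0 * c `^ t), q ^+ j / c) | j <- index_iota 0 n] x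
    = h (c * x) / h l0 * x `^ t.
  rewrite /frac_sum big_map big_mkord.
  rewrite -[h (c * x)]/(geom_frac q p n (c * x) / (c * x) `^ t) /geom_frac.
  rewrite (powRM _ (ltW c0) (ltW x0)) !mulr_suml; apply: eq_bigr => j _ /=.
  have xt : 0 < x `^ t by rewrite powR_gt0.
  have u0 : 0 < q ^+ j by rewrite exprn_gt0.
  have ? : 0 < c * x + q ^+ j by rewrite addr_gt0.
  by field; rewrite !gt_eqF.
have xt : x `^ t <= B.
  apply: le_trans hB; apply: ge0_ler_powR; rewrite ?nnegrE ?(ltW t0) ?(ltW x0)//.
  exact: le_trans (ltW x0) xb.
rewrite -[X in _ - X]mul1r -mulrBl normrM (ger0_norm (powR_ge0 _ _)).
apply: le_trans fe; apply: ler_pM => //; first exact: powR_ge0.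
apply: dist; apply/andP; split.
  by rewrite /c mulrAC ler_pdivlMr// ler_pM2l.
rewrite /c -mulrA ler_pM2l// mulrC ler_pdivrMr//.
apply: le_trans xb _; rewrite -ler_pdivrMr//; apply: le_trans hk _.
by rewrite exprS ler_peMl ?exprn_ge0 ?ltW.
Qed.

End PowerApproximation.

(** * Powers and geometric means of operators *)

Section OperatorPowers.
Variables (R : realType).
Implicit Types H G : realHilbertType R.

Lemma spd_bounds H (A : H -> H) : spd A -> exists a b, [/\ 0 < a, a < b,
  forall x, a * `|x| ^+ 2 <= '[A x, x] & forall x, '[A x, x] <= b * `|x| ^+ 2].
Proof.
move=> /spdP[sA [a a0 aA]]; have [M M0 AM] := form_upper sA.1.
exists a, (a + M); split; rewrite ?ltrDl// => x.
by apply: le_trans (AM x) _; rewrite ler_wpM2r ?sqr_ge0// lerDr ltW.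
Qed.

Lemma spd_bounded_below H (A : H -> H) : spd A -> bounded_below A.
Proof.
move=> /spdP[sA [a a0 aA]]; exists a => // x.
have [->|x0] := eqVneq x 0; first by rewrite normr0 mulr0.
have nx : 0 < `|x| by rewrite normr_gt0.
rewrite -(ler_pM2r nx) -mulrA -expr2; apply: le_trans (aA x) _.
exact: le_trans (ler_norm _) (dot_le _ _).
Qed.

Lemma spd_invop H (A : H -> H) : spd A -> spd (invop A).
Proof.
by move=> /spdP[sA cA]; apply/spdP; split; [exact: symop_invop|exact: coercive_invop].
Qed.

Lemma spd_congruence H G (L : H -> G) (B : G -> G) :
  bounded_op L -> bounded_below L -> spd B -> spd (adjoint L \o B \o L).
Proof.
move=> bL [l l0 hl] /spdP[sB [b b0 bB]]; apply/spdP; split.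
  split; first exact: bounded_op_comp bL (bounded_op_comp sB.1 (bounded_op_adjoint bL)).
  move=> x y /=; rewrite dotC -adjointP// dotC ['[x, adjoint L _]]dotC.
  by rewrite [RHS]dotC -adjointP// sB.2.
exists (b * l ^+ 2); first by rewrite mulr_gt0// exprn_gt0.
move=> x /=; rewrite dotC -adjointP// dotC; apply: le_trans (bB _).
rewrite -mulrA ler_pM2l// -exprMn ler_pXn2r// nnegrE//.
by rewrite mulr_ge0// ltW.
Qed.

Lemma spd_sym H (A : H -> H) : spd A -> symop A.
Proof. by move=> /spdP[]. Qed.

Lemma adjoint_sym H (A : H -> H) : symop A -> adjoint A = A.
Proof. by move=> sA; apply: adjoint_eq; exact: sA.2. Qed.

Lemma op_powP H (A : H -> H) s : spd A -> cfc_eps A (fun l => l `^ s) (op_pow A s).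
Proof.
move=> pA; have sA := spd_sym pA; have [a [b [a0 ab aA bA]]] := spd_bounds pA.
have [K K0 hK] := powR_lipschitz s b a0.
have [T hT] := cfc_eps_exists sA ab aA bA K0 hK.
have : is_cfc (fun l => l `^ s) A (op_pow A s).
  apply: (@xgetPex _ (fun=> 0) [set T | is_cfc (fun l => l `^ s) A T]).
  by exists T; apply/is_cfcP.
by move/is_cfcP; apply.
Qed.

Lemma spectrum_gt0 H (A : H -> H) l : spd A -> spectrum A l -> 0 < l.
Proof.
move=> pA sl; have [a [b [a0 ab aA bA]]] := spd_bounds pA.
have /andP[al _] := spectrum_itv (spd_sym pA) aA bA sl.
exact: lt_le_trans al.
Qed.

Lemma op_powD H (A : H -> H) s u : spd A ->
  cfc_eps A (fun l => l `^ (s + u)) (op_pow A s \o op_pow A u).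
Proof.
move=> pA; have sA := spd_sym pA.
apply: eq_cfc_eps (cfc_eps_mul sA (op_powP s pA) (op_powP u pA)).
by move=> l /(spectrum_gt0 pA) l0; rewrite powRD// (gt_eqF l0) implybT.
Qed.

Lemma op_powNK H (A : H -> H) s : spd A -> op_pow A s \o op_pow A (- s) = idfun.
Proof.
move=> pA; have sA := spd_sym pA.
have -> : idfun = 1 \*: idfun :> (H -> H) by apply/funext => x /=; rewrite scale1r.
apply: (cfc_eps_unique sA) (op_powD s (- s) pA) _.
by apply: eq_cfc_eps (cfc_eps_const sA 1) => l _; rewrite subrr powRr0.
Qed.

Lemma op_pow_half H (A : H -> H) : spd A -> op_pow A 2^-1 \o op_pow A 2^-1 = A.
Proof.
move=> pA; have sA := spd_sym pA.
apply: (cfc_eps_unique sA) (op_powD 2^-1 2^-1 pA) _.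
apply: eq_cfc_eps (cfc_eps_id sA) => l /(spectrum_gt0 pA) l0.
have -> : 2^-1 + 2^-1 = 1 :> R by lra.
by rewrite powRr1// ltW.
Qed.

Lemma spd_op_pow H (A : H -> H) s : spd A -> spd (op_pow A s).
Proof.
move=> pA; have sA := spd_sym pA; have h := op_powP s pA; apply/spdP; split.
  exact: symop_cfc_eps h.
(* An upper bound for l^(-s) on the spectrum is a positive lower bound for l^s. *)
have [M M0 hM] := cfc_eps_bounded sA (op_powP (- s) pA).
exists M^-1; first by rewrite invr_gt0.
apply: (cfc_eps_lower sA h) => l sl; have l0 := spectrum_gt0 pA sl.
have := hM l sl; rewrite ger0_norm ?powR_ge0// powRN => h1.
by rewrite -(invrK (l `^ s)) lef_pV2 ?posrE ?invr_gt0 ?powR_gt0.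
Qed.

Definition geo_core H (A B : H -> H) := op_pow A (- 2^-1) \o B \o op_pow A (- 2^-1).

Lemma spd_geo_core H (A B : H -> H) : spd A -> spd B -> spd (geo_core A B).
Proof.
move=> pA pB; have pS := spd_op_pow (- 2^-1) pA; have sS := spd_sym pS.
have := spd_congruence sS.1 (spd_bounded_below pS) pB.
by rewrite (adjoint_sym sS).
Qed.

Lemma spd_geomean H (A B : H -> H) t : spd A -> spd B -> spd (geomean t A B).
Proof.
move=> pA pB; have pS := spd_op_pow 2^-1 pA; have sS := spd_sym pS.
have := spd_congruence sS.1 (spd_bounded_below pS) (spd_op_pow t (spd_geo_core pA pB)).
by rewrite (adjoint_sym sS).
Qed.

(* Completing the square: the form of T = D (D + s)^-1 is the parallel sum of
   |.|^2 and s^-1 <D ., .>, the minimum over w = T z + d being reached at d = 0. *)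
Lemma parallel_form H (D T : H -> H) (s : R) : symop D -> 0 < s ->
  (forall z, D (T z) + s *: T z = D z) -> forall z d,
  `|T z + d| ^+ 2 + s^-1 * '[D (z - (T z + d)), z - (T z + d)] =
  '[T z, z] + (`|d| ^+ 2 + s^-1 * '[D d, d]).
Proof.
move=> sD s0 DT z d; have linD := sD.1.1.
have Du : D (z - T z) = s *: T z by rewrite (opB linD) -DT addrC addKr.
have -> : z - (T z + d) = (z - T z) - d by rewrite opprD addrA.
have uE : '[T z, z - T z] = '[T z, z] - `|T z| ^+ 2 by rewrite !dotE dotxx.
move: (z - T z) Du uE => u Du uE.
rewrite -!dotxx !(opE linD) Du !dotE ['[D d, u]]sD.2 Du !dotE ['[d, T z]]dotC uE -dotxx.
by field; rewrite gt_eqF.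
Qed.

(** The fraction has Lipschitz constant at most 1/s on the positive reals. The equation for T
    follows from the product rule and uniqueness, and is the form in which [parallel_form] consumes
    T. *)
Lemma frac_op H (D : H -> H) (s : R) : spd D -> 0 < s ->
  exists2 T, cfc_eps D (fun l => l / (l + s)) T &
    forall z, D (T z) + s *: T z = D z.
Proof.
move=> pD s0; have sD := spd_sym pD; have [a [b [a0 ab aD bD]]] := spd_bounds pD.
have s'0 : 0 < s^-1 by rewrite invr_gt0.
have [x y /andP[ax _] /andP[ay _]|T hT] :=
    @cfc_eps_exists _ _ _ (fun l => l / (l + s)) _ _ s^-1 sD ab aD bD s'0.
  have x0 : 0 < x + s by rewrite addr_gt0// (lt_le_trans a0).
  have y0 : 0 < y + s by rewrite addr_gt0// (lt_le_trans a0).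
  have -> : x / (x + s) - y / (y + s) = s / ((x + s) * (y + s)) * (x - y).
    by field; rewrite !gt_eqF.
  rewrite normrM ler_wpM2r// gtr0_norm ?divr_gt0 ?mulr_gt0//.
  rewrite ler_pdivrMr ?mulr_gt0// ler_pdivlMl//.
  by have := lt_le_trans a0 ax; have := lt_le_trans a0 ay; nra.
exists T => // z.
have h := cfc_eps_mul sD (cfc_eps_lin s (cfc_eps_const sD 1) (cfc_eps_id sD)) hT.
have -> : D (T z) + s *: T z = ((fun x => s *: (1 *: x) + D x) \o T) z.
  by rewrite /= scale1r addrC.
congr (_ z); apply: (cfc_eps_unique sD) (cfc_eps_id sD).
apply: eq_cfc_eps h => l sl; have l0 := spectrum_gt0 pD sl.
by field; rewrite gt_eqF// addr_gt0.
Qed.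

Section GeometricMean.
Variables (H : realHilbertType R) (X Y B : H -> H) (m : R).
Hypotheses (pX : spd X) (pY : spd Y) (pB : spd B) (m0 : 0 < m).
Hypothesis XY : forall x, '[X x, x] <= m * '[Y x, x].

(** The change of variables that removes square roots: at vectors A^(1/2) x and A^(1/2) y, the
    quantity of [parallel_form] involves only A and B. *)
Lemma geo_core_form (A : H -> H) (s : R) (pA : spd A) x y :
  `|op_pow A 2^-1 y| ^+ 2 +
    s^-1 * '[geo_core A B (op_pow A 2^-1 x - op_pow A 2^-1 y),
             op_pow A 2^-1 x - op_pow A 2^-1 y] =
  '[A y, y] + s^-1 * '[B (x - y), x - y].
Proof.
set S := op_pow A 2^-1; have sS : symop S := spd_sym (spd_op_pow _ pA).
have sSi : symop (op_pow A (- 2^-1)) := spd_sym (spd_op_pow _ pA).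
have SSi u : op_pow A (- 2^-1) (S u) = u.
  have := op_powNK (- 2^-1) pA; rewrite opprK => h.
  exact: (congr1 (@^~ u) h).
rewrite -(opB sS.1.1) /geo_core /= SSi sSi.2 SSi -dotxx -sS.2.
by rewrite -[S (S y)]/((S \o S) y) op_pow_half.
Qed.

(** The shift s for X is paired with m s for Y, because m <Y y, y> + s^-1 <B ., .> is m times the
    form for Y with shift m s; this puts [l / m] inside the second sum. *)
Lemma frac_sum_form r : all (fun i : R * R => (0 <= i.1) && (0 < i.2)) r ->
  exists T U, [/\ cfc_eps (geo_core X B) (frac_sum r) T,
    cfc_eps (geo_core Y B) (fun l => frac_sum r (l / m)) U &
    forall x, '[T (op_pow X 2^-1 x), op_pow X 2^-1 x] <=
      m * '[U (op_pow Y 2^-1 x), op_pow Y 2^-1 x]].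
Proof.
have sDX := spd_sym (spd_geo_core pX pB); have sDY := spd_sym (spd_geo_core pY pB).
elim: r => [_|[c s] r IH /= /andP[/andP[/= c0 s0] /IH[T [U [hT hU TU]]]]].
  exists (0 \*: idfun), (0 \*: idfun); split.
  - by apply: eq_cfc_eps (cfc_eps_const sDX 0) => l _; rewrite /frac_sum big_nil.
  - by apply: eq_cfc_eps (cfc_eps_const sDY 0) => l _; rewrite /frac_sum big_nil.
  - by move=> x; rewrite /= !dotZl !mul0r mulr0.
have ms0 : 0 < m * s by rewrite mulr_gt0.
have [V hV VE] := frac_op (spd_geo_core pX pB) s0.
have [W hW WE] := frac_op (spd_geo_core pY pB) ms0.
exists (fun x => c *: V x + T x), (fun x => c *: W x + U x); split.
- apply: eq_cfc_eps (cfc_eps_lin c hV hT) => l _.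
  by rewrite /frac_sum big_cons.
- apply: eq_cfc_eps (cfc_eps_lin c hW hU) => l /(spectrum_gt0 (spd_geo_core pY pB)) l0.
  rewrite /frac_sum big_cons /=; congr (_ * _ + _).
  have ? : 0 < l + m * s by rewrite addr_gt0.
  have ? : 0 < l / m + s by rewrite addr_gt0// divr_gt0.
  by field; rewrite !gt_eqF ?addr_gt0 ?mulr_gt0.
move=> x; rewrite !dotE mulrDr lerD//= mulrCA; apply: ler_wpM2l => //.
set z := op_pow Y 2^-1 x.
(* This y attains the minimum for Y; below it is a competitor in the minimum for X. *)
have [y yE] : exists y, op_pow Y 2^-1 y = W z.
  exists (op_pow Y (- 2^-1) (W z)).
  exact: (congr1 (@^~ (W z)) (op_powNK 2^-1 pY)).
have := parallel_form sDY ms0 WE z 0.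
rewrite (op0 sDY.1.1) dot0l normr0 expr0n mulr0 !addr0 -yE geo_core_form// => <-.
set t := op_pow X 2^-1 x.
(* The displacement is chosen so that the competitor V t + d is X^(1/2) y. *)
have := parallel_form sDX s0 VE t (op_pow X 2^-1 y - V t).
rewrite !subrKC geo_core_form// => e.
have : 0 <= `|op_pow X 2^-1 y - V t| ^+ 2 + s^-1 * '[geo_core X B
    (op_pow X 2^-1 y - V t), op_pow X 2^-1 y - V t].
  rewrite addr_ge0 ?sqr_ge0// mulr_ge0 ?invr_ge0 ?(ltW s0)//.
  by apply: coercive_ge0; have /spdP[] := spd_geo_core pX pB.
rewrite -[X in X <= _ -> _](subrr '[V t, t]) lerBlDl -e => h; apply: le_trans h _.
rewrite mulrDr; apply: lerD; first exact: XY.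
by rewrite [leRHS]mulrA invfM mulrA divff ?gt_eqF// mul1r.
Qed.

Lemma geomean_le t : 0 < t < 1 -> forall x,
  '[geomean t X B x, x] <= m `^ (1 - t) * '[geomean t Y B x, x].
Proof.
move=> t01 x; have /andP[t0 t1] := t01.
have pDX := spd_geo_core pX pB; have pDY := spd_geo_core pY pB.
have sDX := spd_sym pDX; have sDY := spd_sym pDY.
have [a [b [a0 ab aX bX]]] := spd_bounds pDX.
have [a' [b' [a'0 ab' aY bY]]] := spd_bounds pDY.
set u := op_pow X 2^-1 x; set v := op_pow Y 2^-1 x.
have geoE A : spd A -> '[geomean t A B x, x] =
    '[op_pow (geo_core A B) t (op_pow A 2^-1 x), op_pow A 2^-1 x].
  by move=> pA; rewrite /geomean /= (spd_sym (spd_op_pow 2^-1 pA)).2.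
rewrite (geoE X pX) (geoE Y pY); apply/ler_addgt0Pr => e e0.
pose c := `|u| ^+ 2 + m * `|v| ^+ 2 + 1.
have c0 : 0 < c by rewrite ltr_wpDl// addr_ge0 ?sqr_ge0// mulr_ge0 ?sqr_ge0// ltW.
have [d d0 dc] : exists2 d, 0 < d & e = d * c.
  by exists (e / c); rewrite ?divr_gt0// divfK// gt_eqF.
(* One interval has to contain the spectrum of the core of X and that of the core of Y divided by m,
   so that a single sum r serves both. *)
pose lo := Num.min a (a' / m); have lo0 : 0 < lo by rewrite lt_min a0 divr_gt0.
have [r rpos hr] := powR_approx (Num.max b (b' / m)) t01 lo0 d0.
have [T [U [hT hU TU]]] := frac_sum_form rpos.
have hX := cfc_eps_dist sDX (op_powP t pDX) hT (ltW d0).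
have hY := cfc_eps_dist sDY
  (cfc_eps_lin (m `^ (- t)) (op_powP t pDY) (cfc_eps_const sDY 0)) hU (ltW d0).
have {}hX := hX _ u.
have {}hY := hY _ v.
have : `| '[op_pow (geo_core X B) t u, u] - '[T u, u]| <= d * `|u| ^+ 2.
  apply: hX => l sl; rewrite distrC; apply: hr.
  have /andP[al lb] := spectrum_itv sDX aX bX sl.
  by rewrite ge_min al le_max lb.
rewrite ler_norml => /andP[_ h1].
have : `| m `^ (- t) * '[op_pow (geo_core Y B) t v, v] - '[U v, v]| <= d * `|v| ^+ 2.
  rewrite /= !dotE mul0r addr0 in hY; apply: hY => l sl; rewrite distrC.
  have /andP[al lb] := spectrum_itv sDY aY bY sl.
  have l0 := spectrum_gt0 pDY sl.
  have -> : m `^ (- t) * l `^ t + 0 = (l / m) `^ t.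
    rewrite addr0 powRM ?invr_ge0 ?(ltW l0) ?(ltW m0)// mulrC; congr (_ * _).
    by rewrite -[m^-1]powR_inv1 ?(ltW m0)// -powRrM mulN1r.
  by apply: hr; rewrite ge_min le_max !ler_pM2r ?invr_gt0// al lb !orbT.
rewrite ler_norml => /andP[h2 _].
have -> : m `^ (1 - t) = m * m `^ (- t).
  by rewrite powRD ?powRr1 ?(ltW m0)// (gt_eqF m0) implybT.
have h3 := TU x; rewrite -/u -/v in h3.
have h4 := ler_wpM2l (ltW m0) h2.
rewrite dc /c; move: h1 h3 h4 d0.
move: '[_, _] '[_, _] '[_, _] '[_, _] (m `^ _) (`|u| ^+ 2) (`|v| ^+ 2).
by move=> p1 p2 p3 p4 p5 p6 p7 h1 h3 h4 d0'; lra.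
Qed.

End GeometricMean.
End OperatorPowers.

(** * Resolvent cocompositions *)

Section ResolventCocomposition.
Variables (R : realType) (H G : realHilbertType R) (L : H -> G) (g : R).
Hypotheses (bL : bounded_op L) (bbL : bounded_below L) (L1 : opnorm L <= 1).
Hypothesis g0 : 0 < g.
Implicit Types M : G -> G.

(** The cocomposition applies [resolvent_comp] to M^-1 with parameter 1/g, so the shift is by g
    itself. *)
Definition shift_inv M : G -> G := (g \*: idfun) \+ invop M.

Definition inner_comp M : H -> H := adjoint L \o invop (shift_inv M) \o L.

Definition resolvent_op M : H -> H := fun x => (- g) *: x + invop (inner_comp M) x.

Definition cocomp M : H -> H := invop (resolvent_op M).

Lemma spd_shift_inv M : spd M -> spd (shift_inv M).
Proof.
move=> pM; have /spdP[sN [n n0 hN]] := spd_invop pM; apply/spdP; split.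
  by apply: symop_add => //; exact/symop_scale/symop_id.
exists n => // x; apply: le_trans (hN x) _.
by rewrite /shift_inv /= !dotE dotxx lerDr mulr_ge0 ?sqr_ge0// ltW.
Qed.

Lemma spd_inner_comp M : spd M -> spd (inner_comp M).
Proof. by move=> pM; exact/spd_congruence/spd_invop/spd_shift_inv. Qed.

Lemma shift_invKr M y : spd M -> shift_inv M (invop (shift_inv M) y) = y.
Proof. by move=> /spd_shift_inv/spdP[? ?]; exact: invopKr. Qed.

Lemma shift_invK M y : spd M -> invop (shift_inv M) (shift_inv M y) = y.
Proof. by move=> /spd_shift_inv/spdP[? ?]; exact: invopK. Qed.

Lemma inner_compKr M x : spd M -> inner_comp M (invop (inner_comp M) x) = x.
Proof. by move=> /spd_inner_comp/spdP[? ?]; exact: invopKr. Qed.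

Lemma inner_compK M x : spd M -> invop (inner_comp M) (inner_comp M x) = x.
Proof. by move=> /spd_inner_comp/spdP[? ?]; exact: invopK. Qed.

(** Completing the square for <C y, y>, C = [shift_inv M], under the constraint L^* y = x: the
    minimiser is C^-1 L u, with u as Lagrange multiplier, and d is the displacement from it. *)
Lemma resolvent_op_form M x y : spd M -> adjoint L y = x ->
  let d := y - invop (shift_inv M) (L (invop (inner_comp M) x)) in
  '[resolvent_op M x, x] + '[shift_inv M d, d] =
  '[invop M y, y] + g * (`|y| ^+ 2 - `|x| ^+ 2).
Proof.
move=> pM yx d; have sC := spd_sym (spd_shift_inv pM); have linC := sC.1.1.
set u := invop (inner_comp M) x in d *.
have ux : '[u, x] = '[L u, y] by rewrite adjointP// yx.
have ux' : '[u, x] = '[L u, invop (shift_inv M) (L u)].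
  by rewrite adjointP// -{1}(inner_compKr x pM).
have -> : '[shift_inv M d, d] = '[shift_inv M y, y] - '[u, x].
  have Cv := shift_invKr (L u) pM.
  have c : '[shift_inv M y, invop (shift_inv M) (L u)] = '[u, x].
    by rewrite sC.2 Cv dotC ux.
  rewrite /d (opB linC) Cv; move: (shift_inv M y) c => Cy c.
  rewrite !dotE c -ux' -ux; lra.
rewrite /resolvent_op -/u /shift_inv /= !dotE !dotxx; lra.
Qed.

Lemma resolvent_op_le M x y : spd M -> adjoint L y = x ->
  '[resolvent_op M x, x] <= '[invop M y, y] + g * (`|y| ^+ 2 - `|x| ^+ 2).
Proof.
move=> pM yx; rewrite -(resolvent_op_form pM yx) lerDl.
by apply: coercive_ge0; have /spdP[] := spd_shift_inv pM.
Qed.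

Lemma resolvent_op_eq M x : spd M -> exists2 y, adjoint L y = x &
  '[resolvent_op M x, x] = '[invop M y, y] + g * (`|y| ^+ 2 - `|x| ^+ 2).
Proof.
move=> pM; pose y := invop (shift_inv M) (L (invop (inner_comp M) x)).
have yx : adjoint L y = x by exact: (inner_compKr x pM).
exists y => //; have := resolvent_op_form pM yx; cbv zeta; rewrite subrr.
by rewrite (op0 (spd_sym (spd_shift_inv pM)).1.1) dot0l addr0.
Qed.

Lemma adjoint_sqr_le y : `|adjoint L y| ^+ 2 <= `|y| ^+ 2.
Proof. by rewrite ler_pXn2r ?nnegrE// adjoint_contraction. Qed.

(** The value at x is attained at some y with L^* y = x, and |x| <= |y| as L is a contraction; the
    coercivity constant of M^-1 is therefore inherited. *)
Lemma spd_resolvent_op M : spd M -> spd (resolvent_op M).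
Proof.
move=> pM; apply/spdP; split.
  by apply: symop_lin; [exact: symop_id|exact/spd_sym/spd_invop/spd_inner_comp].
have /spdP[_ [n n0 hN]] := spd_invop pM; exists n => // x.
have [y yx ->] := resolvent_op_eq x pM.
have h1 := adjoint_sqr_le y; rewrite yx in h1.
have h2 := hN y; have h3 := ler_wpM2l (ltW n0) h1; have h4 := ler_wpM2l (ltW g0) h1.
lra.
Qed.

Lemma spd_cocomp M : spd M -> spd (cocomp M).
Proof. by move=> pM; exact/spd_invop/spd_resolvent_op. Qed.

(** Every operator inverted along the way is bijective: the intermediate points w and u exist for
    one inclusion, and are forced for the other. *)
Lemma cocomp_sv M : spd M -> sv_single (cocomp M) = resolvent_cocomp L g (sv_single M).
Proof.
move=> pM; have /spdP[sQ cQ] := spd_resolvent_op pM; have /spdP[sM cM] := pM.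
apply/funext => x; apply/seteqP; split => y /=.
  move=> ->; set z := cocomp M x; pose u := invop (inner_comp M) z.
  pose w := invop (shift_inv M) (L u).
  exists u.
    exists w; last by rewrite /sv_single /=; exact/esym/(inner_compKr z pM).
    exists (L u) => //; exists (invop M w).
      by rewrite /sv_inv /sv_single /=; exact/esym/invopKr.
    exists (g *: w); first by rewrite /sv_single /= invrK.
    by rewrite addrC; exact: (shift_invKr (L u) pM).
  exists (- g *: z); first by rewrite /sv_single /= invrK.
  by rewrite addrC; exact: (invopKr sQ cQ x).
move=> [u [w [_ -> [p Mp [_ -> pw]]] yw] [_ -> ux]].
move: Mp yw pw ux; rewrite /sv_inv /sv_single /= !invrK => Mp yw pw ux.
have wE : w = invop (shift_inv M) (L u).
  rewrite -(shift_invK w pM) -pw; congr invop.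
  by rewrite /shift_inv /= Mp invopK// addrC.
have uE : u = invop (inner_comp M) y.
  by rewrite yw wE -[adjoint L _]/(inner_comp M u) inner_compK.
by rewrite -ux {1}uE addrC -/(resolvent_op M y) /cocomp invopK.
Qed.

Lemma cocomp_le M M' m : spd M -> spd M' -> 1 <= m ->
  (forall x, '[M x, x] <= m * '[M' x, x]) ->
  forall x, '[cocomp M x, x] <= m * '[cocomp M' x, x].
Proof.
move=> pM pM' m1 MM'; have m0 : 0 < m := lt_le_trans ltr01 m1.
(* Inversion exchanges M and M': the minimiser y for M is now a competitor for M'. *)
apply: invop_le; [exact: spd_resolvent_op|exact: spd_resolvent_op|done|] => x.
have [y yx ->] := resolvent_op_eq x pM.
apply: le_trans (resolvent_op_le pM' yx) _.
have h1 := invop_le pM pM' m0 MM' y.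
have h2 := adjoint_sqr_le y; rewrite yx in h2.
have h3 : 0 <= (m - 1) * (g * (`|y| ^+ 2 - `|x| ^+ 2)).
  by rewrite !mulr_ge0 ?subr_ge0// ltW.
lra.
Qed.

End ResolventCocomposition.

(** * The Thompson metric and contractions *)

Section Thompson.
Variables (R : realType) (H : realHilbertType R).
Implicit Types A B : H -> H.

Lemma spd_comparable A B : spd A -> spd B ->
  exists2 K : R, 1 <= K & forall x, '[A x, x] <= K * '[B x, x].
Proof.
move=> /spdP[sA cA] /spdP[sB [b b0 hB]]; have [M M0 hA] := form_upper sA.1.
have Mb : 0 < M / b by rewrite divr_gt0.
exists (M / b + 1); first by rewrite lerDr ltW.
move=> x; apply: le_trans (hA x) _.
have h0 : 0 <= '[B x, x] by apply: coercive_ge0; exists b.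
apply: (@le_trans _ _ (M / b * '[B x, x])).
  by rewrite -mulrA ler_pM2l// ler_pdivlMl.
by rewrite ler_wpM2r// lerDl.
Qed.

Lemma spd_le_anti A B : spd A -> spd B ->
  (forall e : R, 0 < e -> forall x, '[A x, x] <= (1 + e) * '[B x, x]) ->
  (forall e : R, 0 < e -> forall x, '[B x, x] <= (1 + e) * '[A x, x]) -> A = B.
Proof.
have lim A' B' : spd B' ->
    (forall e : R, 0 < e -> forall x, '[A' x, x] <= (1 + e) * '[B' x, x]) ->
    forall x, '[A' x, x] <= '[B' x, x].
  move=> /spdP[_ cB] h x; apply/ler_addgt0Pr => e e0.
  have B0 := coercive_ge0 x cB.
  have d0 : 0 < e / ('[B' x, x] + 1) by rewrite divr_gt0// ltr_wpDl.
  apply: le_trans (h _ d0 x) _; rewrite mulrDl mul1r lerD2l mulrAC.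
  by rewrite ler_pdivrMr ?ltr_wpDl// ler_pM2l// lerDl.
move=> pA pB AB BA; apply: symop_eq (spd_sym pA) (spd_sym pB) _ => x.
by apply/eqP; rewrite eq_le !lim.
Qed.

Lemma gaugeP A B (l : R) : spd A -> spd B ->
  (0 < l /\ loewner_le A (l \*: B)) <-> 0 < l /\ forall x, '[A x, x] <= l * '[B x, x].
Proof.
move=> pA pB; have sA := spd_sym pA; have sB := spd_sym pB.
have E : loewner_le A (l \*: B) <-> forall x, '[A x, x] <= l * '[B x, x].
  split=> [/(loewnerP sA (symop_scale _ sB)) h x|h].
    by have := h x; rewrite /= dotZl.
  by apply/(loewnerP sA (symop_scale _ sB)) => x; rewrite /= dotZl.
by split=> -[l0 /E h].
Qed.

Lemma gauge_le A B (l : R) : spd A -> spd B -> 0 < l ->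
  (forall x, '[A x, x] <= l * '[B x, x]) -> thompson_gauge A B <= l.
Proof.
move=> pA pB l0 h; apply: ge_inf; last exact/(gaugeP _ pA pB).
by exists 0 => k [k0 _]; exact: ltW.
Qed.

Lemma gauge_ge0 A B : spd A -> spd B -> 0 <= thompson_gauge A B.
Proof.
move=> pA pB; apply: lb_le_inf; last by move=> k [k0 _]; exact: ltW.
have [K K1 hK] := spd_comparable pA pB; exists K; apply/(gaugeP _ pA pB).
by split=> //; exact: lt_le_trans K1.
Qed.

(** The comparison passes to the infimum even if the gauge is 0, a value that its defining set
    excludes. *)
Lemma le_gauge A B (l : R) : spd A -> spd B -> thompson_gauge A B <= l ->
  forall x, '[A x, x] <= l * '[B x, x].
Proof.
move=> pA pB hl x; apply/ler_addgt0Pr => e e0.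
have B0 : 0 <= '[B x, x] by apply: coercive_ge0; have /spdP[] := pB.
have d0 : 0 < e / ('[B x, x] + 1) by rewrite divr_gt0// ltr_wpDl.
have iE : has_inf [set l : R | 0 < l /\ loewner_le A (l \*: B)].
  split; last by exists 0 => k [k0 _]; exact: ltW.
  have [K K1 hK] := spd_comparable pA pB; exists K; apply/(gaugeP _ pA pB).
  by split=> //; exact: lt_le_trans K1.
have [k /(gaugeP _ pA pB)[k0 hk] kl] := inf_adherent d0 iE.
apply: le_trans (hk x) _.
have kl' : k <= l + e / ('[B x, x] + 1).
  by apply: le_trans (ltW kl) _; rewrite lerD2r.
apply: le_trans (ler_wpM2r B0 kl') _; rewrite mulrDl lerD2l mulrAC.
by rewrite ler_pdivrMr ?ltr_wpDl// ler_pM2l// lerDl.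
Qed.

Lemma thompson_dist_trivial A B : (forall x : H, x = 0) -> spd A -> spd B ->
  thompson_dist A B = 0.
Proof.
move=> H0 pA pB; have g0 A' B' : spd A' -> spd B' -> thompson_gauge A' B' = 0.
  move=> pA' pB'; apply/eqP; rewrite eq_le gauge_ge0// andbT.
  apply/ler_addgt0Pr => e e0; rewrite add0r; apply: gauge_le => // x.
  by rewrite [B' x]H0 [A' x]H0 !dot0l mulr0.
by rewrite /thompson_dist !g0// maxxx ln0.
Qed.

End Thompson.

(** * Fixed points of maps that contract order comparisons *)

Section Contraction.
Variables (R : realType) (H : realHilbertType R) (t : R) (phi : (H -> H) -> H -> H).
Hypothesis t01 : 0 < t < 1.
Hypothesis phi_spd : forall X, spd X -> spd (phi X).
Hypothesis phi_le : forall X Y m, spd X -> spd Y -> 1 <= m ->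
  (forall x, '[X x, x] <= m * '[Y x, x]) ->
  forall x, '[phi X x, x] <= m `^ (1 - t) * '[phi Y x, x].

Let t0 : 0 < t. Proof. by case/andP: t01. Qed.
Let t1 : 0 < 1 - t. Proof. by rewrite subr_gt0; case/andP: t01. Qed.

Lemma powR_ge1 (K s : R) : 1 <= K -> 0 <= s -> 1 <= K `^ s.
Proof. by move=> K1 s0; rewrite -[leLHS](powRr0 K) ler_powR. Qed.

(** Used with c = 1 for uniqueness and c = t for [kappa]. *)
Lemma powR_exp_small (K c e : R) : 1 <= K -> 0 < e -> 0 < c ->
  exists N, forall n, (N <= n)%N -> K `^ ((1 - t) ^+ n / c) <= 1 + e.
Proof.
move=> K1 e0 c0; have le0 : 0 < ln (1 + e) by rewrite ln_gt0// ltrDl.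
have lK : 0 <= ln K by rewrite ln_ge0.
have r1 : 1 < (1 - t)^-1 by rewrite invf_gt1// gtrBl.
have [N hN] := expr_unbounded ((ln K + 1) / (c * ln (1 + e))) r1.
exists N => n Nn; have K0 : 0 < K := lt_le_trans ltr01 K1.
have e10 : 0 < 1 + e by rewrite addr_gt0.
rewrite /powR gt_eqF// -[leRHS](lnK e10) ler_expR.
have hn : (1 - t) ^+ n <= (1 - t) ^+ N.
  by apply: ler_wiXn2l Nn; rewrite ?(ltW t1)// gerBl ltW.
have tN : 0 < (1 - t) ^+ N by rewrite exprn_gt0.
have tn : 0 < (1 - t) ^+ n by rewrite exprn_gt0.
move: hN; rewrite exprVn ler_pdivrMr ?mulr_gt0// ler_pdivlMl// => hN.
rewrite mulrAC ler_pdivrMr//; apply: le_trans (ler_wpM2r lK hn) _.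
by nra.
Qed.

(** The product of K^((1 - t)^j) over j >= n, i.e. of the comparison constants of all later Picard
    steps: the geometric tail sums to (1 - t)^n / t. *)
Definition kappa K n : R := K `^ ((1 - t) ^+ n / t).

Lemma kappa_ge1 K n : 1 <= K -> 1 <= kappa K n.
Proof. by move=> K1; apply: powR_ge1 => //; rewrite divr_ge0// ?exprn_ge0 ?ltW. Qed.

Lemma kappaS K n : kappa K n.+1 = kappa K n `^ (1 - t).
Proof. by rewrite /kappa -powRrM exprSr mulrAC. Qed.

Lemma kappa_step K n : 0 < K -> kappa K n = K `^ ((1 - t) ^+ n) * kappa K n.+1.
Proof.
move=> K0; rewrite -powRD ?(gt_eqF K0) ?implybT//; congr (_ `^ _).
by rewrite exprS; field; rewrite gt_eqF.
Qed.

(** Applying [phi] n times to a comparison of two fixed points leaves them unchanged and turns the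
    constant K into K^((1 - t)^n). *)
Lemma fixpoint_unique X Y : spd X -> spd Y -> phi X = X -> phi Y = Y -> X = Y.
Proof.
have le A B : spd A -> spd B -> phi A = A -> phi B = B ->
    forall e : R, 0 < e -> forall x, '[A x, x] <= (1 + e) * '[B x, x].
  move=> pA pB fA fB e e0 x; have [K K1 hK] := spd_comparable pA pB.
  have it n : forall x, '[A x, x] <= K `^ ((1 - t) ^+ n) * '[B x, x].
    elim: n => [|n IH]; first by rewrite expr0 powRr1// (le_trans ler01).
    rewrite -{1}fA -{1}fB exprSr powRrM; apply: phi_le => //.
    by apply: powR_ge1 => //; rewrite exprn_ge0// ltW.
  have [N /(_ N (leqnn N))] := powR_exp_small K1 e0 ltr01; rewrite divr1 => hN.
  apply: le_trans (it N x) _; apply: ler_wpM2r hN.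
  by apply: coercive_ge0; have /spdP[] := pB.
by move=> pX pY fX fY; apply: spd_le_anti => //; exact: le.
Qed.

(* The iterates satisfy X_n <= kappa_n / kappa_k X_k for n <= k, and conversely,
   with kappa_n decreasing to 1; hence they form a Cauchy sequence. *)
Lemma fixpoint_exists : exists2 X, spd X & phi X = X.
Proof.
have pI : spd (idfun : H -> H).
  apply/spdP; split; first exact: symop_id.
  by exists 1 => // x; rewrite mul1r dotxx.
pose X_ n := iter n phi idfun; have pX n : spd (X_ n).
  by elim: n => [|n IH]; [exact: pI|exact: (phi_spd IH)].
have X0 n x : 0 <= '[X_ n x, x] by apply: coercive_ge0; have /spdP[] := pX n.
have [K K1 hK] : exists2 K, 1 <= K & forall x,
    '[X_ 0%N x, x] <= K * '[X_ 1%N x, x] /\ '[X_ 1%N x, x] <= K * '[X_ 0%N x, x].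
  have [K K1 hK] := spd_comparable (pX 0%N) (pX 1%N).
  have [K' K'1 hK'] := spd_comparable (pX 1%N) (pX 0%N).
  exists (Num.max K K'); first by rewrite le_max K1.
  move=> x; split; [apply: le_trans (hK x) _|apply: le_trans (hK' x) _];
    by rewrite ler_wpM2r// le_max lexx ?orbT.
have K0 : 0 < K := lt_le_trans ltr01 K1.
have k1 n : 1 <= K `^ ((1 - t) ^+ n) by apply: powR_ge1 => //; rewrite exprn_ge0// ltW.
have step n x : '[X_ n x, x] <= K `^ ((1 - t) ^+ n) * '[X_ n.+1 x, x] /\
    '[X_ n.+1 x, x] <= K `^ ((1 - t) ^+ n) * '[X_ n x, x].
  elim: n x => [|n IH] x; first by rewrite expr0 powRr1 ?(ltW K0).
  rewrite exprSr powRrM; split.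
    by apply: (phi_le (pX n) (pX n.+1) (k1 n)) => y; exact: (IH y).1.
  by apply: (phi_le (pX n.+1) (pX n) (k1 n)) => y; exact: (IH y).2.
pose kp := kappa K; have kp1 n : 1 <= kp n by exact: kappa_ge1.
have kp0 n : 0 < kp n := lt_le_trans ltr01 (kp1 n).
(* The constant kp n / kp (n + d) is the product of the steps from n to n + d - 1; it is kept in
   cross-multiplied form. *)
have cmp n d x : kp (n + d)%N * '[X_ n x, x] <= kp n * '[X_ (n + d)%N x, x] /\
    kp (n + d)%N * '[X_ (n + d)%N x, x] <= kp n * '[X_ n x, x].
  elim: d => [|d IH]; first by rewrite addn0.
  rewrite addnS; have kE := kappa_step (n + d) K0; rewrite -/kp in kE.
  have kk0 : 0 < K `^ ((1 - t) ^+ (n + d)) := lt_le_trans ltr01 (k1 _).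
  have [s1 s2] := step (n + d)%N x; case: IH; rewrite kE => i1 i2.
  have s1' := ler_wpM2l (ltW (kp0 n)) s1.
  split; last first.
    apply: le_trans (ler_wpM2l (ltW (kp0 (n + d).+1)) s2) _.
    by rewrite mulrCA mulrA.
  rewrite -(ler_pM2l kk0).
  by rewrite mulrA; apply: le_trans i1 _; rewrite [leRHS]mulrCA.
have cmpl n k x : (n <= k)%N -> '[X_ n x, x] <= kp n * '[X_ k x, x] /\
    '[X_ k x, x] <= kp n * '[X_ n x, x].
  move=> nk; have := cmp n (k - n)%N x; rewrite subnKC// => -[c1 c2].
  by split; [apply: le_trans c1|apply: le_trans c2]; rewrite ler_peMl.
have up k x : '[X_ k x, x] <= kp 0%N * `|x| ^+ 2.
  by have [_] := cmpl 0%N k x (leq0n k); rewrite /= dotxx.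
have kps (e : R) : 0 < e -> exists N, forall n, (N <= n)%N -> kp n <= 1 + e.
  by move=> e0; exact: powR_exp_small.
have sX n : symop (X_ n) := spd_sym (pX n).
have [e e0|X sX' hX] := @symop_limit _ H X_ sX.
  have e1 : 0 < e / kp 0%N by rewrite divr_gt0.
  have [N hN] := kps _ e1; exists N.
  have main n k : (N <= n)%N -> (n <= k)%N -> forall x, `|X_ n x - X_ k x| <= e * `|x|.
    move=> Nn nk; apply: (symop_norm (T := X_ n \- X_ k)) => [||x].
    - exact: symop_sub.
    - exact: ltW.
    (* Each one-sided difference of forms is at most kp n - 1 times a form bounded by kp 0 |x|^2;
       [symop_norm] makes this an operator norm estimate. *)
    have [c1 c2] := cmpl n k x nk; have un := up n x; have uk := up k x.
    have := hN n Nn; rewrite -lerBlDl => hn.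
    have hn0 : 0 <= kp n - 1 by rewrite subr_ge0.
    have xx := sqr_ge0 `|x|.
    have b u : u <= kp 0%N * `|x| ^+ 2 -> (kp n - 1) * u <= e * `|x| ^+ 2.
      move=> hu; apply: le_trans (ler_wpM2l hn0 hu) _.
      rewrite mulrA; apply: ler_wpM2r => //.
      by rewrite -ler_pdivlMr.
    have b1 := b _ un; have b2 := b _ uk.
    by rewrite /= !dotE ler_norml; apply/andP; split; lra.
  move=> n k nN kN x; have [nk|kn] := leqP n k; first exact: main.
  by rewrite distrC; apply: main => //; exact: ltnW.
have conv (e : R) x n : 0 < e -> exists2 k, (n <= k)%N &
    `| '[X_ k x, x] - '[X x, x]| <= e.
  move=> e0; have x1 : 0 < `|x| ^+ 2 + 1 by rewrite ltr_wpDl// sqr_ge0.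
  have e1 : 0 < e / (`|x| ^+ 2 + 1) by rewrite divr_gt0.
  have [N hN] := hX _ e1; exists (maxn n N); first exact: leq_maxl.
  rewrite -dotNl -dotDl; apply: le_trans (dot_le _ _) _.
  apply: le_trans (ler_wpM2r (normr_ge0 x) (hN _ (leq_maxr n N) x)) _.
  by rewrite -(mulrA (e / _)) -expr2 mulrAC ler_pdivrMr// ler_pM2l// lerDl.
have lo n x : '[X_ n x, x] <= kp n * '[X x, x].
  apply/ler_addgt0Pr => e e0.
  have [k nk] := conv _ x n (divr_gt0 e0 (kp0 n)).
  rewrite ler_norml => /andP[_]; rewrite lerBlDr => hk.
  apply: le_trans (cmpl n k x nk).1 _.
  apply: le_trans (ler_wpM2l (ltW (kp0 n)) hk) _.
  by rewrite mulrDr [kp n * (e / _)]mulrC divfK ?gt_eqF// addrC.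
have hi n x : '[X x, x] <= kp n * '[X_ n x, x].
  apply/ler_addgt0Pr => e e0; have [k nk] := conv _ x n e0.
  rewrite ler_norml => /andP[+ _]; rewrite lerBrDr addrC lerBlDr => hk.
  by apply: le_trans hk _; rewrite lerD2r (cmpl n k x nk).2.
(* Coercivity of the limit comes from its comparison with X_0, the identity. *)
have pXl : spd X.
  apply/spdP; split=> //; exists (kp 0%N)^-1; first by rewrite invr_gt0.
  by move=> x; rewrite ler_pdivrMl//; have := lo 0%N x; rewrite /= dotxx.
(* By [kappaS], [phi] turns the bounds between X_n and X into bounds between X_n+1 and phi X with
   the next constant. Thus X and phi X both lie within kp n.+1 of X_n+1. *)
have lo' n x : '[X_ n.+1 x, x] <= kp n.+1 * '[phi X x, x].
  by rewrite /kp kappaS; exact: (phi_le (pX n) pXl (kp1 n) (lo n)).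
have hi' n x : '[phi X x, x] <= kp n.+1 * '[X_ n.+1 x, x].
  by rewrite /kp kappaS; exact: (phi_le pXl (pX n) (kp1 n) (hi n)).
have sq (e : R) : 0 < e -> exists n, kp n.+1 * kp n.+1 <= 1 + e.
  (* For d <= 1, (1 + d)^2 <= 1 + 3 d. *)
  move=> e0; have [|N hN] := kps (Num.min 1 (e / 3)).
    by rewrite lt_min ltr01 divr_gt0.
  exists N; have := hN N.+1 (leqnSn N); have := kp1 N.+1.
  have : Num.min 1 (e / 3) <= 1 by rewrite ge_min lexx.
  have : Num.min 1 (e / 3) <= e / 3 by rewrite ge_min lexx orbT.
  by move: (Num.min _ _) (kp _) => d k; nra.
exists X => //; apply: (spd_le_anti (phi_spd pXl) pXl) => e /sq[n hn] x.
- apply: le_trans (hi' n x) _.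
  apply: le_trans (ler_wpM2l (ltW (kp0 n.+1)) (lo n.+1 x)) _.
  by rewrite mulrA ler_wpM2r//; apply: coercive_ge0; have /spdP[] := pXl.
- apply: le_trans (hi n.+1 x) _.
  apply: le_trans (ler_wpM2l (ltW (kp0 n.+1)) (lo' n x)) _.
  by rewrite mulrA ler_wpM2r//; apply: coercive_ge0; have /spdP[] := phi_spd pXl.
Qed.

End Contraction.

(** * Lipschitz estimate for the cocomposition of a geometric mean *)

Section GeometricMeanCocomposition.
Variables (R : realType) (H G : realHilbertType R) (L : H -> G) (B : G -> G) (g t : R).
Hypotheses (bL : bounded_op L) (bbL : bounded_below L) (L1 : opnorm L <= 1).
Hypotheses (pB : spd B) (g0 : 0 < g) (t01 : 0 < t < 1).

Let phi X := cocomp L g (geomean t X B).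

Lemma cocomp_geomean_spd X : spd X -> spd (phi X).
Proof. by move=> pX; exact/spd_cocomp/spd_geomean. Qed.

Lemma cocomp_geomean_le X Y m : spd X -> spd Y -> 1 <= m ->
  (forall x, '[X x, x] <= m * '[Y x, x]) ->
  forall x, '[phi X x, x] <= m `^ (1 - t) * '[phi Y x, x].
Proof.
move=> pX pY m1 XY; apply: cocomp_le => //; try exact: spd_geomean.
  by apply: powR_ge1 => //; rewrite subr_ge0 ltW//; case/andP: t01.
by apply: geomean_le => //; exact: lt_le_trans m1.
Qed.

(* The maximum of the gauges is below 1 only if G = {0}; then H = {0} as well and
   all distances are ln 0 = 0. *)
Lemma cocomp_geomean_lipschitz X Y : spd X -> spd Y ->
  thompson_dist (phi X) (phi Y) <= (1 - t) * thompson_dist X Y.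
Proof.
move=> pX pY; set m := Num.max (thompson_gauge X Y) (thompson_gauge Y X).
have /andP[t0 t1] := t01; have t'0 : 0 < 1 - t by rewrite subr_gt0.
have pfX := cocomp_geomean_spd pX; have pfY := cocomp_geomean_spd pY.
have XY l : m <= l -> forall x, '[X x, x] <= l * '[Y x, x].
  by move=> ml; apply: le_gauge => //; apply: le_trans ml; rewrite le_max lexx.
have YX l : m <= l -> forall x, '[Y x, x] <= l * '[X x, x].
  by move=> ml; apply: le_gauge => //; apply: le_trans ml; rewrite le_max lexx orbT.
have [m1|m1] := leP 1 m.
  have m0 : 0 < m := lt_le_trans ltr01 m1.
  rewrite {2}/thompson_dist -/m -ln_powR /thompson_dist.
  set M := Num.max _ _; have Mm : M <= m `^ (1 - t).
    rewrite ge_max; apply/andP; split.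
      apply: (gauge_le pfX pfY (powR_gt0 _ m0)).
      exact: (cocomp_geomean_le pX pY m1 (XY _ (lexx _))).
    apply: (gauge_le pfY pfX (powR_gt0 _ m0)).
    exact: (cocomp_geomean_le pY pX m1 (YX _ (lexx _))).
  (* M can be 0 when H is trivial although G is not; then ln M = 0, while ln of m^(1 - t) is
     nonnegative. *)
  have [M0|M0] := ltP 0 M; first by rewrite ler_ln ?posrE ?powR_gt0.
  by rewrite (ln0 M0) ln_ge0// powR_ge1// ltW.
have [l ml l1] : exists2 l, m <= l & 0 < l < 1.
  have m0 : 0 <= m by rewrite le_max gauge_ge0.
  by exists ((m + 1) / 2); [lra|apply/andP; split; lra].
(* X <= l Y <= l^2 X with l < 1 forces the form of X to vanish, and X is coercive. *)
have trivG (x : G) : x = 0.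
  have /spdP[_ [a a0 hX]] := pX; have h := hX x.
  have h1 := XY l ml x; have h2 := YX l ml x.
  have X0 : 0 <= '[X x, x] by apply: coercive_ge0; exists a.
  have /andP[l0 l1'] := l1.
  have h3 : '[X x, x] <= 0.
    have l2 : 0 < 1 - l ^+ 2 by rewrite subr_gt0 exprn_ilt1// ltW.
    have := ler_wpM2l (ltW l0) h2; rewrite -(pmulr_rle0 _ l2); lra.
  apply/eqP; rewrite -normr_eq0 -sqrf_eq0 eq_le sqr_ge0 andbT.
  by rewrite -(pmulr_rle0 _ a0) (le_trans h).
have trivH (x : H) : x = 0.
  have [a a0 hL] := bbL; apply/eqP; rewrite -normr_le0 -(pmulr_rle0 _ a0).
  by apply: le_trans (hL x) _; rewrite (trivG (L x)) normr0.
by rewrite !thompson_dist_trivial// mulr0.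
Qed.

End GeometricMeanCocomposition.

(** The cocomposition is set-valued, so the map of (i) is asserted to exist as a function; the
    equation with [sv_single] then determines each phi X. *)
Theorem proposition5p3 (R : realType) :
  (* (i) *)
  (forall (H G : realHilbertType R) (L : H -> G) (B : G -> G) (gamma t : R),
    bounded_op L -> bounded_below L -> opnorm L <= 1 -> spd B ->
    0 < gamma -> 0 < t < 1 ->
    exists phi : (G -> G) -> (H -> H),
      (forall X, spd X -> spd (phi X) /\
         sv_single (phi X)
         = resolvent_cocomp L gamma (sv_single (geomean t X B))) /\
      (forall X Y, spd X -> spd Y ->
         thompson_dist (phi X) (phi Y) <= (1 - t) * thompson_dist X Y)) /\
  (* (ii) *)
  (forall (H : realHilbertType R) (L : H -> H) (B : H -> H) (gamma t : R),
    bounded_op L -> bounded_below L -> opnorm L <= 1 -> spd B ->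
    0 < gamma -> 0 < t < 1 ->
    exists! X : H -> H, spd X /\
      sv_single X = resolvent_cocomp L gamma (sv_single (geomean t X B))).
Proof.
split=> [H G L B g t bL bbL L1 pB g0 t01|H L B g t bL bbL L1 pB g0 t01].
  exists (fun X => cocomp L g (geomean t X B)); split=> [X pX|X Y pX pY].
    split; first exact: cocomp_geomean_spd.
    by apply: cocomp_sv => //; exact: spd_geomean.
  exact: cocomp_geomean_lipschitz.
pose phi X := cocomp L g (geomean t X B).
have fixE X : spd X ->
    sv_single X = resolvent_cocomp L g (sv_single (geomean t X B)) <-> phi X = X.
  move=> pX; rewrite -cocomp_sv//; last exact: spd_geomean.
  split=> [e|e]; last by rewrite -[in LHS]e.
  (* [sv_single] is injective: X x belongs to the singleton of phi X x. *)
  apply/funext => x; have := congr1 (fun f => f x (X x)) e.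
  by rewrite /sv_single /= => e'; symmetry; rewrite -e'.
have phi_spd X : spd X -> spd (phi X) by exact: cocomp_geomean_spd.
have phi_le := cocomp_geomean_le bL bbL L1 pB g0 t01.
have [X pX XE] := fixpoint_exists t01 phi_spd phi_le.
exists X; split=> [|Y [pY /(fixE Y pY) YE]]; first by split=> //; exact/fixE.
exact: (fixpoint_unique t01 phi_le).
Qed.
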